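(* Let $M$ be a smooth closed Riemannian manifold. Let $K$ be a compact set (with respect to the weak-* topology) in the space of Borel probability measures on $\mathrm{Homeo}(M)$ such that: (1) for every $\mu\in K$, $\mathrm{supp}(\mu)\subset \mathrm{Lip}(M)$; (2) there exist $\alpha>0$ and $C_0$ such that $\int_{\mathrm{Lip}(M)}(\log\mathfrak{L}(f))^\alpha\,d\mu(f)<C_0$ for every $\mu\in K$; (3) for every $\mu\in K$ there are no Borel probability measures $m_1,m_2$ on $M$ such that $f_*m_1=m_2$ for $\mu$-a.e. $f$. Then (with this $\alpha$) there exist $C<\infty$ and $\kappa>1$ such that for every Borel probability measure $\nu_0$ on $M$, every sequence $\mu_1,\mu_2,\ldots\in K$, every $n\in\mathbb{N}$, every $x\in M$, and every $r$ with $e^{-\kappa^n}<r<1$, $$[\mu_n*\mu_{n-1}*\cdots*\mu_1*\nu_0](B_r(x))<C|\log r|^{-\alpha/2}.$$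
   Context: $d$ is the Riemannian distance on $M$, $B_r(x)$ the ball of radius $r$ centered at $x$. $\mathrm{Homeo}(M)$ is the group of homeomorphisms of $M$ with the topology of uniform convergence; $\mathrm{Lip}(M)\subset \mathrm{Homeo}(M)$ is the set of bi-Lipschitz homeomorphisms, and $\mathfrak{L}(f)=\max\left(\sup_{x\neq y}\frac{d(f(x),f(y))}{d(x,y)},\ \sup_{x\ne y}\frac{d(f^{-1}(x),f^{-1}(y))}{d(x,y)}\right)$. For a probability measure $\mu$ on $\mathrm{Homeo}(M)$ and a Borel probability measure $\nu$ on $M$, $\mu*\nu=\int (f_*\nu)\,d\mu(f)$; iterated expressions are $\mu_n*(\mu_{n-1}*(\cdots*(\mu_1*\nu_0)))$. The weak-* topology on measures on $\mathrm{Homeo}(M)$ is that of convergence against bounded continuous functions. *)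

(* Defs.v *)
From HB Require Import structures.
From mathcomp Require Import all_boot all_order all_algebra.
From mathcomp Require Import all_classical all_reals all_analysis.

Set Implicit Arguments.
Unset Strict Implicit.
Unset Printing Implicit Defensive.

Import Order.TTheory GRing.Theory Num.Theory.
Import numFieldNormedType.Exports.

Local Open Scope classical_set_scope.
Local Open Scope ring_scope.

(* The library's measurable types are pointed, hence so are our metric spaces
   (only the empty space is lost). *)
#[short(type="pmetricType")]
HB.structure Definition PointedMetric (K : numDomainType) :=
  { M of Metric K M & isPointed M }.

Section smooth_maps.
Context {R : realType} {V W : normedModType R}.

(* Only meant for an open set U and a finite-dimensional V. *)
Fixpoint Ck_on (k : nat) (U : set V) (f : V -> W) : Prop :=
  match k with
  | 0 => {in U, continuous f}
  | k'.+1 => {in U, forall x, differentiable f x} /\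
             (forall v, Ck_on k' U (fun x => 'D_v f x))
  end.

Definition smooth_on (U : set V) (f : V -> W) := forall k, Ck_on k U f.

End smooth_maps.

Section riemannian.
Context {R : realType}.

(* [cinv] is the inverse chart; only its values on [cfun @` cdom] matter. *)
Record chart (n : nat) (M : topologicalType) := Chart {
  cdom : set M;
  cfun : M -> 'rV[R]_n;
  cinv : 'rV[R]_n -> M;
  cdom_open : open cdom;
  cimg_open : open (cfun @` cdom);
  cfunK : {in cdom, cancel cfun cinv};
  cfun_continuous : {in cdom, continuous cfun};
  cinv_continuous : {in cfun @` cdom, continuous cinv}
}.

Definition cimg n (M : topologicalType) (c : chart n M) := cfun c @` cdom c.

Definition gram_form n (G : 'M[R]_n) (v w : 'rV[R]_n) : R := (v *m G *m w^T) 0 0.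

(* A smooth atlas of dimension n on M together with a smooth Riemannian metric:
   [rmetric i p] is the Gram matrix, in the chart i, of the inner product on
   the tangent space at the point of coordinates p. *)
Record riemannian (n : nat) (M : topologicalType) := Riemannian {
  rindex : Type;
  rchart : rindex -> chart n M;
  rchart_cover : forall x, exists i, cdom (rchart i) x;
  rchart_smooth : forall i j,
    smooth_on (cfun (rchart i) @` (cdom (rchart i) `&` cdom (rchart j)))
              (cfun (rchart j) \o cinv (rchart i));
  rmetric : rindex -> 'rV[R]_n -> 'M[R]_n;
  rmetric_smooth : forall i, smooth_on (cimg (rchart i)) (rmetric i);
  rmetric_sym : forall i p, cimg (rchart i) p -> (rmetric i p)^T = rmetric i p;
  rmetric_gt0 : forall i p v, cimg (rchart i) p -> v != 0 ->
    0 < gram_form (rmetric i p) v v;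
  rmetric_compat : forall i j x v w,
    cdom (rchart i) x -> cdom (rchart j) x ->
    let p := cfun (rchart i) x in
    let tau := cfun (rchart j) \o cinv (rchart i) in
    gram_form (rmetric i p) v w = gram_form (rmetric j (tau p)) ('D_v tau p) ('D_w tau p)
}.

Section distance.
Context {n : nat} {M : topologicalType} (g : riemannian n M).

(* A C^1 arc [0, 1] -> M contained in the domain of the chart i, given by its
   coordinates c. A C^1 function on [0, 1] extends to a C^1 function on R, so
   that c is taken C^1 on R. *)
Definition C1_arc (i : rindex g) (c : R -> 'rV[R]_n) : Prop :=
  [/\ forall t, derivable c t 1,
      continuous (derive1 c) &
      forall t, t \in `[0, 1] -> cimg (rchart i) (c t)].

Definition arc_length (i : rindex g) (c : R -> 'rV[R]_n) : R :=
  \int[lebesgue_measure]_(t in `[0, 1])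
    Num.sqrt (gram_form (rmetric i (c t)) (derive1 c t) (derive1 c t)).

(* [curve x y l]: some piecewise C^1 curve from x to y has length l. By
   compactness, a piecewise C^1 curve can be subdivided so that each piece is
   a C^1 arc within one chart domain. *)
Inductive curve : M -> M -> R -> Prop :=
| curve_nil x : curve x x 0
| curve_cons i c y l : C1_arc i c -> curve (cinv (rchart i) (c 1)) y l ->
    curve (cinv (rchart i) (c 0)) y (arc_length i c + l).

Definition riemannian_dist (x y : M) : R := inf [set l | curve x y l].

End distance.

(* A closed connected Riemannian manifold of dimension n whose Riemannian
   distance is the distance of M. *)
Record closed_riemannian (n : nat) (M : metricType R) := ClosedRiemannian {
  cr_riemannian :> riemannian n M;
  cr_compact : compact [set: M];
  cr_connected : connected [set: M];
  cr_dist : forall x y : M, mdist x y = riemannian_dist cr_riemannian x y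
}.

End riemannian.
Arguments riemannian R n M : clear implicits.
Arguments closed_riemannian R n M : clear implicits.

Section borel_probabilities.
Context (R : realType) (X : ptopologicalType).

Definition borel := g_sigma_algebraType (@open X).
HB.instance Definition _ := Measurable.on borel.

Definition borel_prob : Type := probability borel R.
HB.instance Definition _ := Choice.on borel_prob.

Definition bounded_continuous : Type :=
  {phi : X -> R | continuous phi /\ exists B : R, forall x, `|phi x| <= B}.

Definition integral_against (mu : borel_prob) :
    prod_topology (fun _ : bounded_continuous => R) :=
  fun phi => \int[mu]_x (sval phi x).

(* the weak-* topology *)
HB.instance Definition _ :=
  Topological.copy borel_prob (initial_topology integral_against).

Definition supp (mu : borel_prob) : set X :=
  [set x | forall U : set X, open U -> U x -> (0 < mu U)%E].

End borel_probabilities.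

Section homeomorphisms.
Context (R : realType).

Record homeo (M : topologicalType) := Homeo {
  hfun :> M -> M;
  hinv : M -> M;
  hfun_continuous : continuous hfun;
  hinv_continuous : continuous hinv;
  hfunK : cancel hfun hinv;
  hinvK : cancel hinv hfun
}.

Definition homeo_id (M : topologicalType) : homeo M :=
  @Homeo M id id (fun _ => cvg_id) (fun _ => cvg_id)
    (fun _ => erefl) (fun _ => erefl).

HB.instance Definition _ (M : topologicalType) := gen_eqMixin (homeo M).
HB.instance Definition _ (M : topologicalType) := gen_choiceMixin (homeo M).
HB.instance Definition _ (M : topologicalType) :=
  isPointed.Build (homeo M) (homeo_id M).

(* the topology of uniform convergence *)
HB.instance Definition _ (M : uniformType) :=
  Uniform.copy (homeo M)
    (initial_topology (fun f : homeo M => (f : M -> M) : {uniform M -> M})).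

Definition bilipschitz (M : metricType R) : set (homeo M) :=
  [set f : homeo M | exists k : R, forall x y,
    mdist (f x) (f y) <= k * mdist x y /\
    mdist (hinv f x) (hinv f y) <= k * mdist x y].

Definition lip_const (M : metricType R) (f : M -> M) : \bar R :=
  ereal_sup [set ((mdist (f p.1) (f p.2)) / mdist p.1 p.2)%:E
            | p in [set p : M * M | p.1 != p.2]].

Definition bilip_const (M : metricType R) (f : homeo M) : \bar R :=
  maxe (lip_const f) (lip_const (hinv f)).

End homeomorphisms.

Section convolution.
Context {R : realType} {M : pmetricType R}.
Implicit Types (mu : borel_prob R (homeo M)) (nu : set (borel M) -> \bar R).

(* mu * nu = \int f_* nu dmu(f) *)
Definition convolution mu nu : set (borel M) -> \bar R :=
  fun A => (\int[mu]_f pushforward nu (hfun f : borel M -> borel M) A)%E.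

(* mu_n * ( ... * (mu_1 * nu0)), where mu_k is [mus k.-1]. *)
Fixpoint iter_convolution (mus : nat -> borel_prob R (homeo M)) nu0 (n : nat)
    : set (borel M) -> \bar R :=
  if n is m.+1 then convolution (mus m) (iter_convolution mus nu0 m) else nu0.

End convolution.

(* Main.v *)
Require Import Defs.
From HB Require Import structures.
From mathcomp Require Import all_boot all_order all_algebra.
From mathcomp Require Import all_classical all_reals all_analysis.
From mathcomp Require Import measurable_realfun ring lra.
Set Implicit Arguments.
Unset Strict Implicit.
Unset Printing Implicit Defensive.
Import Order.TTheory GRing.Theory Num.Theory.
Import numFieldNormedType.Exports.
Local Open Scope classical_set_scope.
Local Open Scope ring_scope.

(** Only the compact metric space underlying [M] matters. With weights
    [w_j = (j + 1)^alpha - j^alpha], the kernel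
    [k_N(z) = \sum_(j < N) w_j 1_(z < e^-j)] is [|log z|^alpha] truncated at the
    scale [e^-N]; let [E_N(nu)] be the double integral of [k_N(d(x, y))] against
    [nu]. Then [E_N(nu) <= N^alpha], and [N^alpha nu(B_r)^2 <= E_N(nu)] as soon
    as [2 r <= e^(1 - N)], so that everything follows from a contraction
    [E_N(mu * nu) <= (1 - delta) E_N(nu) + C], uniform in [mu] in [K], [nu] and
    [N]: iterating it [n] times makes [E_N] bounded for [N <= kappa^n].

    As [k_N] varies slowly, a bi-Lipschitz map changes energies by a factor
    [1 + eps] and an additive error controlled by the moment condition. In any
    metric space the mass of pairs of two measures at distance less than [r] is
    at most the mean of their self-masses at distance [2 r]; this replaces the
    positive definiteness of the kernel, which would need a smooth structure.
    The same inequality with weights [1 + eta psi] and [1 - eta psi] shows that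
    if the contraction fails along [mu_n], [nu_n], then the probabilities
    obtained by normalising [k_N(d(x, y)) nu(dy) nu(dx)], for [nu = nu_n] and
    for [nu = mu_n * nu_n], are nearly exchanged by [f] for [mu_n]-most [f].
    Their ultralimits [m1], [m2] and the limit [mu] in [K] of the [mu_n] satisfy
    [f_* m1 = m2] on the support of [mu], which is excluded. *)

(** * The truncated logarithmic kernel *)

Section log_kernel.
Context {R : realType} (a : R) (a0 : 0 < a).

(** Fix c with (1+c)^a = 1+e. If t <= c x, then x+t <= (1+c) x and the first term suffices;
    otherwise x < t/c, so x+t <= (1+1/c) t and the second one does. *)
Lemma powR_slow (e : R) : 0 < e -> exists2 C : R, 0 <= C &
  forall x t : R, 0 <= x -> 0 <= t -> (x + t) `^ a <= (1 + e) * x `^ a + C * t `^ a.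
Proof.
move=> e0; pose c := (1 + e) `^ a^-1 - 1.
have a_neq0 : a != 0 by rewrite gt_eqF.
have c0 : 0 < c.
  have one : (1 : R) `^ a^-1 = 1 by rewrite powR1.
  by rewrite subr_gt0 -[ltLHS]one gt0_ltr_powR ?invr_gt0 ?nnegrE//; lra.
have cE : (1 + c) `^ a = 1 + e.
  by rewrite addrC subrK -powRrM mulVf// powRr1//; lra.
exists ((1 + c^-1) `^ a) => [|x t x0 t0]; first exact: powR_ge0.
have [tcx|xct] := leP t (c * x).
  apply: (@le_trans _ _ ((1 + e) * x `^ a)); last first.
    by rewrite lerDl mulr_ge0// powR_ge0.
  have c1 : 0 <= 1 + c by lra.
  rewrite -cE -(powRM a c1 x0); apply: ge0_ler_powR; rewrite ?nnegrE.
  - exact: ltW.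
  - exact: addr_ge0.
  - exact: mulr_ge0.
  - by lra.
apply: (@le_trans _ _ ((1 + c^-1) `^ a * t `^ a)); last first.
  by rewrite lerDr mulr_ge0 ?powR_ge0//; lra.
have c1 : 0 <= 1 + c^-1 by rewrite addr_ge0// invr_ge0 ltW.
rewrite -(powRM a c1 t0); apply: ge0_ler_powR; rewrite ?nnegrE.
- exact: ltW.
- exact: addr_ge0.
- exact: mulr_ge0.
- by rewrite mulrDl mul1r addrC lerD2l mulrC ler_pdivlMr// mulrC ltW.
Qed.

Definition weight (j : nat) : R := j.+1%:R `^ a - j%:R `^ a.

Lemma weight_ge0 j : 0 <= weight j.
Proof.
by rewrite subr_ge0 ge0_ler_powR ?nnegrE ?ler0n ?ler_nat// ltW.
Qed.

Lemma sum_weight n : \sum_(j < n) weight j = n%:R `^ a.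
Proof.
elim: n => [|n ih]; first by rewrite big_ord0 powR0// gt_eqF.
by rewrite big_ord_recr /= ih addrC subrK.
Qed.

(* A truncation, at the scale [expR (- N)], of [(- ln z) `^ a]. *)
Definition log_kernel (N : nat) (z : R) : R :=
  \sum_(j < N) weight j * (z < expR (- j%:R))%R%:R.

Lemma log_kernel_le N z : log_kernel N z <= N%:R `^ a.
Proof.
rewrite -sum_weight; apply: ler_sum => j _.
by rewrite -[leRHS]mulr1 ler_wpM2l ?weight_ge0 ?lern1 ?leq_b1.
Qed.

Lemma sum_weight_le (N m : nat) :
  \sum_(j < N) weight j * (j < m)%:R <= m%:R `^ a.
Proof.
have powge n : 0 <= n%:R `^ a by exact: powR_ge0.
have [mN|Nm] := leqP m N; last first.
  apply: (@le_trans _ _ (N%:R `^ a)).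
    rewrite -sum_weight; apply: ler_sum => j _.
    by rewrite -[leRHS]mulr1 ler_wpM2l ?weight_ge0 ?lern1 ?leq_b1.
  by rewrite ge0_ler_powR ?nnegrE ?ler0n ?ler_nat ?(ltnW Nm)// ltW.
rewrite -(sum_weight m) (big_ord_widen N weight mN) [leRHS]big_mkcond/=.
by apply: ler_sum => j _; case: (ltnP j m) => _; rewrite ?mulr1 ?mulr0.
Qed.

(** Let J be the first scale with e^-J <= z. Then k_N(z) >= J^a, while z' >= e^-s z >= e^-(J+s)
    leaves only the indices j < J+s in k_N(z'), which is thus at most (J+1+s)^a; [powR_slow]
    concludes. *)
Lemma log_kernel_slow (e : R) : 0 < e -> exists2 C : R, 0 <= C &
  forall N (z z' s : R), 0 <= s -> z <= expR s * z' ->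
    log_kernel N z' <= (1 + e) * log_kernel N z + C * (1 + s) `^ a.
Proof.
move=> e0; have [C C0 HC] := powR_slow e0.
exists C => // N z z' s s0 zz'.
have Cs0 : 0 <= C * (1 + s) `^ a by rewrite mulr_ge0// powR_ge0.
(* If all the scales e^-j with j < N exceed z, the kernel at z already has its largest value N^a. *)
have [/existsP[i0 zi0]|/existsPn near] :=
    boolP [exists i : 'I_N, (expR (- i%:R) <= z)%R]; last first.
  apply: le_trans (log_kernel_le N z') _.
  suff -> : log_kernel N z = N%:R `^ a.
    rewrite mulrDl mul1r -addrA lerDl addr_ge0// mulr_ge0 ?powR_ge0//.
    exact: ltW.
  rewrite -sum_weight; apply: eq_bigr => j _.
  by move: (near j); rewrite -ltNge => ->; rewrite mulr1.
pose p := fun k : nat => expR (- k%:R) <= z.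
have exJ : exists k, p k by exists i0.
case: (ex_minnP exJ) => J pJ minJ.
have JN : (J <= N)%N by rewrite (leq_trans (minJ _ zi0))// ltnW.
have kzJ : J%:R `^ a <= log_kernel N z.
  rewrite -sum_weight (big_ord_widen N weight JN) /= big_mkcond/=.
  apply: ler_sum => j _; case: ifP => jJ; last by rewrite mulr_ge0 ?weight_ge0.
  suff -> : z < expR (- j%:R) by rewrite mulr1.
  by rewrite ltNge; apply/negP => /minJ; rewrite leqNgt jJ.
pose m := (J + (Num.trunc s).+1)%N.
apply: (@le_trans _ _ (m%:R `^ a)).
  apply: le_trans (sum_weight_le N m).
  apply: ler_sum => j _; rewrite ler_wpM2l ?weight_ge0//.
  case: (ltP z') => // z'j; rewrite ler_nat lt0b.
  have : expR (- J%:R) < expR (s - j%:R).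
    rewrite (le_lt_trans pJ)// (le_lt_trans zz')// expRD ltr_pM2l//.
    exact: expR_gt0.
  rewrite ltr_expR ltrBrDr addrC => jJs.
  rewrite -(ltr_nat R) natrD (@lt_trans _ _ (J%:R + s))//; first by lra.
  by rewrite ltrD2l; exact: truncnS_gt.
have mE : m%:R <= J%:R + (1 + s).
  by rewrite natrD lerD2l -addn1 natrD addrC lerD2l truncn_le.
apply: (@le_trans _ _ ((J%:R + (1 + s)) `^ a)).
  by rewrite ge0_ler_powR ?nnegrE// ?ler0n ?(ltW a0)// (le_trans _ mE).
apply: le_trans (HC _ _ (ler0n R J) _) _; first by lra.
by rewrite lerD2r ler_wpM2l//; lra.
Qed.

End log_kernel.

(** * Metric spaces and the homeomorphism group *)

Section compact_metric.
Context {R : realType} {M : pmetricType R}.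

Lemma ball_mdist (x y : M) (r : R) : ball x r y = (mdist x y < r) :> Prop.
Proof. by rewrite ballEmdist. Qed.

Lemma open_mball (x : M) (r : R) : open (ball x r).
Proof.
rewrite openE => y; rewrite ball_mdist => xy; apply/nbhs_ballP.
exists (r - mdist x y) => /=; first lra.
by move=> z; rewrite !ball_mdist => yz; have := metric_triangle x y z; lra.
Qed.

Lemma mdist_lt_add (z x y : M) (r s : R) :
  mdist z x < r -> mdist z y < s -> mdist x y < r + s.
Proof. by have := metric_triangle x z y; rewrite (metric_sym x z); lra. Qed.

Lemma compact_dense_sequence : compact [set: M] ->
  exists s : nat -> M, forall x (e : R), 0 < e -> exists n, mdist (s n) x < e.
Proof.
move=> cM; have [B cB [oB bB]] := compact_second_countable cM.
have /pfcard_geP[B0|[F]] := cB.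
  have := bB point setT (filterT); rewrite B0.
  by move=> /= [U [/=]].
(* [get] picks a point of each basic open set; for an empty one it returns the default point, which
   does no harm. *)
exists (fun n => get (F n)) => x e e0.
have [U [BU xU Ue]] := bB x (ball x e) (nbhsx_ballx _ _ e0).
have [n _ FU] : range F U by exact: surj.
exists n; rewrite metric_sym -ball_mdist; apply: Ue; rewrite FU; exact: (@getI _ U x).
Qed.


End compact_metric.

(** * Borel measurability on M and on Homeo(M) *)

Section borel_measurability.
Context {R : realType}.

Lemma open_borel (X : ptopologicalType) (A : set X) :
  open A -> measurable (A : set (borel X)).
Proof. by move=> oA; apply: sub_sigma_algebra. Qed.

Lemma closed_borel (X : ptopologicalType) (A : set X) :
  closed A -> measurable (A : set (borel X)).
Proof.
move=> cA; rewrite -[A]setCK; apply: measurableC.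
by apply: open_borel; exact: closed_openC.
Qed.

Lemma continuous_borel (X Y : ptopologicalType) (f : X -> Y) :
  continuous f -> measurable_fun setT (f : borel X -> borel Y).
Proof.
move=> /continuousP cf; apply: (@measurability _ _ (borel X) (borel Y) setT f (@open Y) erefl).
move=> _ [A oA <-]; rewrite setTI; apply: open_borel; exact: cf.
Qed.

Lemma continuous_borel_real (X : ptopologicalType) (f : X -> R) :
  continuous f -> measurable_fun setT (f : borel X -> R).
Proof.
move=> /continuousP cf; apply: (measurability _ (measurable_realfun.RGenOpens.measurableE R)).
move=> _ [A [x [y ->]] <-]; rewrite setTI; apply: open_borel; apply: cf.
exact: interval_open.
Qed.

End borel_measurability.

Section homeo_topology.
Context {R : realType} {M : pmetricType R}.

Lemma homeo_near (f : homeo M) (e : R) : 0 < e ->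
  nbhs f [set g : homeo M | forall x, mdist (f x) (g x) < e].
Proof.
move=> e0.
have : continuous (fun f : homeo M => (f : M -> M) : {uniform M -> M}).
  exact: initial_continuous.
move=> /(_ f).
set U := [set g : {uniform M -> M} | forall x, mdist (f x) (g x) < e].
move=> /(_ U); apply; apply/uniform_nbhs.
exists [set xy | mdist xy.1 xy.2 < e]; split.
  rewrite -entourage_ballE; exists e => //= -[x y] /=.
  by rewrite -[X in X -> _]/(ball x e y) ball_mdist.
by move=> g /= H x; exact: H.
Qed.

End homeo_topology.

Section evaluation.
Context {R : realType} {M : pmetricType R} (cM : compact [set: M]).

Lemma homeo_open (A : set (homeo M)) :
  (forall f, A f -> exists2 e : R, 0 < e &
    forall g : homeo M, (forall x, mdist (f x) (g x) < e) -> A g) -> open A.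
Proof.
move=> H; rewrite openE => f /H[e e0 He].
by apply: filterS (homeo_near f e0) => g; exact: He.
Qed.

(** Measurability refers to the product sigma-algebra, so this open set is written as a countable
    union of products of balls centred on a dense sequence. *)
Lemma measurable_mdist_lt (r : R) :
  measurable [set p : borel M * borel M | mdist (p.1 : M) p.2 < r].
Proof.
have [s ds] := compact_dense_sequence cM.
have key (x y : M) : mdist x y < r -> exists n k,
    ball (s n) k.+1%:R^-1 x /\ ball (s n) (r - k.+1%:R^-1) y.
  move=> xyr; have e0 : 0 < (r - mdist x y) / 2 by lra.
  have [k] := ltr_add_invr e0; rewrite add0r => ke.
  have [//|n snx] := ds x k.+1%:R^-1 _.
  exists n, k; rewrite !ball_mdist; split => //.
  have := metric_triangle (s n) x y.
  by set q := _^-1 in ke snx *; lra.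
rewrite [X in measurable X](_ : _ = \bigcup_n \bigcup_k
  ((ball (s n) k.+1%:R^-1 : set (borel M)) `*`
   (ball (s n) (r - k.+1%:R^-1) : set (borel M)))).
  apply: bigcupT_measurable => n; apply: bigcupT_measurable => k.
  by apply: measurableX; apply: open_borel; exact: open_mball.
apply/seteqP; split => [[x y] /= xyr|[x y] [n _ [k _ [/=]]]]; last first.
  rewrite !ball_mdist => snx sny /=.
  by rewrite -(subrKC k.+1%:R^-1 r) (mdist_lt_add snx sny).
by have [n [k [snx sny]]] := key _ _ xyr; exists n => //; exists k.
Qed.

(** Countably many rectangles again: f x lies in U exactly when f sends some ball of a countable
    family containing x to points at distance at least 1/(l+1) from the complement of U, for some l.
    For a fixed ball and a fixed l this is a closed condition on f. *)
Lemma measurable_eval : measurable_fun setT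
  (fun p : borel (homeo M) * borel M => (p.1 : homeo M) p.2 : borel M).
Proof.
have [s ds] := compact_dense_sequence cM.
apply: (@measurability _ _ _ (borel M) _ _ (@open M) erefl).
move=> _ [U oU <-]; rewrite setTI.
pose A n k l := [set f : homeo M | forall y, mdist (s n) y < k.+1%:R^-1 ->
  forall w, ~ U w -> l.+1%:R^-1 <= mdist (f y) w].
rewrite [X in measurable X](_ : _ = \bigcup_n \bigcup_k \bigcup_l
  ((A n k l : set (borel (homeo M))) `*`
   (ball (s n) k.+1%:R^-1 : set (borel M)))).
  apply: bigcupT_measurable => n; apply: bigcupT_measurable => k.
  apply: bigcupT_measurable => l; apply: measurableX; last first.
    by apply: open_borel; exact: open_mball.
  apply: closed_borel; rewrite -openC; apply: homeo_open => f.
  move=> /existsNP[y /not_implyP[sy /existsNP[w /not_implyP[Uw /negP]]]].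
  rewrite -ltNge => fyw; exists (l.+1%:R^-1 - mdist (f y) w).
    by rewrite subr_gt0.
  move=> g fg /(_ y sy w Uw); apply/negP; rewrite -ltNge.
  apply: le_lt_trans (metric_triangle _ (f y) _) _.
  by rewrite -ltrBrDr metric_sym.
apply/seteqP; split => [[f x] /= Ufx|[f x] [n _ [k _ [l _ [/=]]]]]; last first.
  rewrite ball_mdist => Af /Af; apply: contrapT => H.
  have [//|Ufx] := pselect (U (f x)); exfalso; apply: H => H.
  by have := H _ Ufx; rewrite mdistxx leNgt invr_gt0 ltr0n.
have /nbhs_ballP[e /= e0 He] : nbhs (f x) U by exact: open_nbhs_nbhs.
have e2 : 0 < e / 2 by lra.
have [l] := ltr_add_invr e2; rewrite add0r => le.
have /nbhs_ballP[d /= d0 Hd] := @hfun_continuous _ f x _ (nbhsx_ballx _ _ e2).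
have d2 : 0 < d / 2 by lra.
have [k] := ltr_add_invr d2; rewrite add0r => kd.
have [//|n snx] := ds x k.+1%:R^-1 _.
exists n => //; exists k => //; exists l => //; split => /=.
  move=> y sy w Uw; rewrite leNgt; apply/negP => fyw; apply: Uw; apply: He.
  have : ball (f x) (e / 2) (f y).
    apply: Hd; rewrite ball_mdist (lt_trans (mdist_lt_add snx sy))//.
    by set q := _^-1 in kd *; lra.
  rewrite !ball_mdist metric_sym => fxy.
  apply: lt_trans (mdist_lt_add fxy fyw) _.
  by set q := _^-1 in le *; lra.
by rewrite ball_mdist.
Qed.

End evaluation.

(** * Integrals of bounded measurable functions *)

Section bounded_measurable.
Context {R : realType}.

(** This class is stable under algebraic operations and partial integration, and its members are
    integrable against every probability, so that all integrals can be handled as real numbers. *)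
Definition bmf d (T : measurableType d) (f : T -> R) :=
  measurable_fun setT f /\ exists B, forall x, `|f x| <= B.

Section closure.
Context d (T : measurableType d).
Implicit Types f g : T -> R.

Lemma bmf_cst (c : R) : bmf (fun _ : T => c).
Proof. by split; [exact: measurable_cst|exists `|c|]. Qed.

Lemma bmfD f g : bmf f -> bmf g -> bmf (fun x => f x + g x).
Proof.
move=> [mf [B fB]] [mg [C gC]]; split; first exact: measurable_funD.
by exists (B + C) => x; rewrite (le_trans (ler_normD _ _))// lerD.
Qed.

Lemma bmfM f g : bmf f -> bmf g -> bmf (fun x => f x * g x).
Proof.
move=> [mf [B fB]] [mg [C gC]]; split; first exact: measurable_funM.
by exists (B * C) => x; rewrite normrM ler_pM.
Qed.

Lemma bmfZ c f : bmf f -> bmf (fun x => c * f x).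
Proof. by apply: bmfM; exact: bmf_cst. Qed.

Lemma bmfB f g : bmf f -> bmf g -> bmf (fun x => f x - g x).
Proof.
move=> bf bg; rewrite (_ : (fun x => f x - g x) = fun x => f x + (-1) * g x).
  by apply: bmfD => //; exact: bmfZ.
by apply/funext => x; rewrite mulN1r.
Qed.

Lemma bmf_norm f : bmf f -> bmf (fun x => `|f x|).
Proof.
move=> [mf [B fB]]; split; first exact: measurableT_comp.
by exists B => x; rewrite normr_id.
Qed.

Lemma bmf_sum n (F : 'I_n -> T -> R) :
  (forall i, bmf (F i)) -> bmf (fun x => \sum_(i < n) F i x).
Proof.
elim: n F => [|n ih] F bF.
  rewrite (_ : (fun _ => _) = fun=> 0); first exact: bmf_cst.
  by apply/funext => x; rewrite big_ord0.
rewrite (_ : (fun _ => _) = fun x =>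
    \sum_(i < n) F (widen_ord (leqnSn n) i) x + F ord_max x).
  by apply: bmfD => //; exact: ih.
by apply/funext => x; rewrite big_ord_recr.
Qed.

Lemma bmf_comp d' (T' : measurableType d') (phi : T' -> T) f :
  measurable_fun setT phi -> bmf f -> bmf (f \o phi).
Proof.
by move=> mphi [mf [B fB]]; split; [exact: measurableT_comp|exists B => x /=].
Qed.

Lemma bmf_indic (A : set T) : measurable A -> bmf (\1_A : T -> R).
Proof.
move=> mA; split; first exact: measurable_indic.
by exists 1 => x; rewrite indicE ger0_norm// lern1 leq_b1.
Qed.

End closure.

Section integral.
Context d (T : measurableType d) (P : probability T R).
Implicit Types f g : T -> R.

Lemma bmf_integrable f : bmf f -> P.-integrable setT (EFin \o f).
Proof.
move=> [mf [B fB]]; apply: measurable_bounded_integrable => //.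
  by rewrite (le_lt_trans (probability_le1 P _))// ltry.
exists B; split; first exact: num_real.
by move=> C BC x _; exact: le_trans (fB x) (ltW BC).
Qed.

Lemma EFin_Rint f : bmf f -> (\int[P]_x f x)%:E = (\int[P]_x (f x)%:E)%E.
Proof.
move=> /bmf_integrable intf; rewrite /Rintegral fineK//.
exact: integrable_fin_num.
Qed.

Lemma le_Rint f g : bmf f -> bmf g -> (forall x, f x <= g x) ->
  \int[P]_x f x <= \int[P]_x g x.
Proof.
by move=> bf bg fg; apply: le_Rintegral => //; exact: bmf_integrable.
Qed.

Lemma RintD f g : bmf f -> bmf g ->
  \int[P]_x (f x + g x) = \int[P]_x f x + \int[P]_x g x.
Proof. by move=> bf bg; rewrite RintegralD//; exact: bmf_integrable. Qed.

Lemma RintB f g : bmf f -> bmf g ->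
  \int[P]_x (f x - g x) = \int[P]_x f x - \int[P]_x g x.
Proof. by move=> bf bg; rewrite RintegralB//; exact: bmf_integrable. Qed.

Lemma RintZ c f : bmf f -> \int[P]_x (c * f x) = c * \int[P]_x f x.
Proof. by move=> bf; rewrite RintegralZl//; exact: bmf_integrable. Qed.

Lemma Rint_cst c : \int[P]_x c = c.
Proof. by have /= P1 := probability_setT P; rewrite Rintegral_cst//= P1 mulr1. Qed.

Lemma Rint_sum n (F : 'I_n -> T -> R) : (forall i, bmf (F i)) ->
  \int[P]_x (\sum_(i < n) F i x) = \sum_(i < n) \int[P]_x F i x.
Proof.
elim: n F => [|n ih] F bF.
  by rewrite big_ord0; under eq_Rintegral do rewrite big_ord0; exact: Rint_cst.
under eq_Rintegral do rewrite big_ord_recr/=.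
by rewrite RintD// ?ih ?big_ord_recr//; exact: bmf_sum.
Qed.

Lemma Rint_ge0 f : (forall x, 0 <= f x) -> 0 <= \int[P]_x f x.
Proof. by move=> f0; exact: Rintegral_ge0. Qed.

Lemma Rint_indic A : measurable A -> \int[P]_x \1_A x = fine (P A).
Proof. by move=> mA; rewrite /Rintegral integral_indic// setIT. Qed.

End integral.

Section product.
Context d1 d2 (T1 : measurableType d1) (T2 : measurableType d2).
Context (P1 : probability T1 R) (P2 : probability T2 R).
Implicit Type f : T1 * T2 -> R.

Lemma bmf_section f x : bmf f -> bmf (fun y => f (x, y)).
Proof. by move=> bf; apply: (bmf_comp (measurable_pair1 x)). Qed.

Lemma bmf_Rint f : bmf f -> bmf (fun x => \int[P2]_y f (x, y)).
Proof.
move=> bf; have intf := bmf_integrable (P1 \x P2)%E bf; split.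
  have := measurable_fubini_F intf.
  move/(measurableT_comp (@fine_measurable R setT measurableT)); exact.
have [B fB] := bf.2; exists B => x.
have bfx := bmf_section x bf.
rewrite ler_norml -{1}[- B](Rint_cst P2) -{2}[B](Rint_cst P2).
by apply/andP; split; apply: le_Rint => //; try exact: bmf_cst;
  move=> y; have := fB (x, y); rewrite ler_norml => /andP[].
Qed.

Lemma Rint_fubini f : bmf f ->
  \int[(P1 \x P2)%E]_p f p = \int[P1]_x \int[P2]_y f (x, y).
Proof.
move=> bf; apply: EFin_inj; rewrite !EFin_Rint//; last exact: bmf_Rint.
rewrite -(integral12_prod_meas1 (bmf_integrable _ bf)).
by apply: eq_integral => x _; rewrite EFin_Rint//; exact: bmf_section.
Qed.

End product.

Lemma Rint_pushforward d d' (T : measurableType d) (T' : measurableType d')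
    (P : probability T R) (X : {mfun T >-> T'}) (f : T' -> R) :
  bmf f -> \int[distribution P X]_y f y = \int[P]_x f (X x).
Proof.
move=> bf; apply: EFin_inj; rewrite !EFin_Rint//; last first.
  exact: bmf_comp.
rewrite integral_pushforward//; first exact/measurable_EFinP/(proj1 bf).
by rewrite preimage_setT; exact/bmf_integrable/bmf_comp.
Qed.

End bounded_measurable.

(** * The convolution as a probability measure *)

Section convolution_probability.
Context {R : realType} {M : pmetricType R} (cM : compact [set: M]).

(** [rho] is the law of f x when (f, x) is distributed according to the product of [mu] and [nu];
    Fubini computes its integrals. *)
Lemma convolution_probability (mu : borel_prob R (homeo M)) (nu : borel_prob R M) :
  exists rho : borel_prob R M,
    (forall A : set (borel M), measurable A -> convolution mu nu A = rho A) /\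
    (forall h : borel M -> R, bmf h ->
       bmf (fun f : borel (homeo M) => \int[nu]_x h ((f : homeo M) x)) /\
       \int[rho]_y h y = \int[mu]_f \int[nu]_x h (hfun f x)).
Proof.
pose ev : {mfun (borel (homeo M) * borel M)%type >-> borel M} :=
  mfun_Sub (mem_set (measurable_eval cM)).
exists (distribution (mu \x nu)%E ev); split => [A mA|h bh].
  apply: eq_integral => f _; rewrite /= /pushforward /=; congr (nu _).
  by apply/seteqP; split => x; rewrite /xsection /= inE.
have bhe : bmf (h \o ev) by exact: bmf_comp.
by rewrite Rint_pushforward// (Rint_fubini mu nu bhe); split => //; exact: (bmf_Rint mu nu bhe).
Qed.

End convolution_probability.

(** * The cross inequality *)

Section cross_inequality.
Context {R : realType}.

Lemma bmf_inv d (T : measurableType d) (f : T -> R) (e : R) :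
  0 < e -> (forall x, e <= f x) -> bmf f -> bmf (fun x => (f x)^-1).
Proof.
move=> e0 fe [mf _].
have f0 x : 0 < f x by exact: lt_le_trans (fe x).
rewrite (_ : (fun x => _) = (@powR R)^~ (-1) \o f); last first.
  by apply/funext => x /=; rewrite powR_inv1// ltW.
split; first by apply: measurableT_comp => //; exact: measurable_powR.
exists e^-1 => x /=; rewrite powR_inv1 ?(ltW (f0 x))//.
by rewrite ger0_norm ?invr_ge0 ?(ltW (f0 x))// lef_pV2// posrE.
Qed.

Lemma Rint_swap d1 d2 (T1 : measurableType d1) (T2 : measurableType d2)
    (P1 : probability T1 R) (P2 : probability T2 R) (f : T1 * T2 -> R) :
  bmf f -> bmf (fun y => \int[P1]_x f (x, y)) /\
    \int[P1]_x \int[P2]_y f (x, y) = \int[P2]_y \int[P1]_x f (x, y).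
Proof.
move=> bf; have bfs : bmf (fun p : T2 * T1 => f (p.2, p.1)).
  exact: (bmf_comp (@measurable_swap _ _ _ _) bf).
have bG : bmf (fun y => \int[P1]_x f (x, y)) := bmf_Rint P2 P1 bfs.
split => //; apply: EFin_inj; rewrite !EFin_Rint//; last exact: (bmf_Rint P1 P2 bf).
transitivity (\int[P1]_x \int[P2]_y (f (x, y))%:E)%E.
  by apply: eq_integral => x _; rewrite EFin_Rint//; exact: bmf_section.
rewrite (Fubini (bmf_integrable (P1 \x P2)%E bf)).
by apply: eq_integral => y _; rewrite EFin_Rint//; exact: (bmf_section y bfs).
Qed.

Context {M : pmetricType R} (cM : compact [set: M]).

Definition ball_mass (nu : borel_prob R M) (r : R) (x : M) : R :=
  fine (nu (ball x r)).

Definition close_pairs (r : R) : set (borel M * borel M) :=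
  [set p | mdist (p.1 : M) p.2 < r].

Lemma bmf_close_pairs r : bmf (\1_(close_pairs r) : _ -> R).
Proof. by apply: bmf_indic; exact: measurable_mdist_lt. Qed.

Lemma ball_massE nu r (x : M) :
  ball_mass nu r x = \int[nu]_y \1_(close_pairs r) (x, y).
Proof.
transitivity (\int[nu]_y \1_(ball x r : set (borel M)) y).
  by rewrite Rint_indic//; apply: open_borel; exact: open_mball.
apply: eq_Rintegral => y _; rewrite !indicE; congr (nat_of_bool _)%:R.
by apply/idP/idP; rewrite !inE /close_pairs /= ballEmdist.
Qed.

Lemma ball_massEl nu r (y : M) :
  ball_mass nu r y = \int[nu]_x \1_(close_pairs r) (x, y).
Proof.
rewrite ball_massE; apply: eq_Rintegral => x _; rewrite !indicE.
congr (nat_of_bool _)%:R.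
by apply/idP/idP; rewrite !inE /close_pairs /= metric_sym.
Qed.

Lemma bmf_ball_mass nu r : bmf (ball_mass nu r : borel M -> R).
Proof.
rewrite (_ : ball_mass nu r = fun x => \int[nu]_y \1_(close_pairs r) (x, y)).
  exact: (bmf_Rint nu nu (bmf_close_pairs r)).
by apply/funext => x; rewrite ball_massE.
Qed.

Lemma ball_mass_ge0 nu r x : 0 <= ball_mass nu r x.
Proof. exact/fine_ge0/measure_ge0. Qed.

Lemma ball_mass_le1 nu r x : ball_mass nu r x <= 1.
Proof.
have mb : measurable (ball x r : set (borel M)).
  by apply: open_borel; exact: open_mball.
rewrite -[leRHS]/(fine 1%E) /ball_mass fine_le//.
  exact: fin_num_measure.
exact: probability_le1.
Qed.

Lemma ball_mass_mono nu r s (x y : M) :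
  ball x r `<=` ball y s -> ball_mass nu r x <= ball_mass nu s y.
Proof.
have mb z t : measurable (ball z t : set (borel M)).
  by apply: open_borel; exact: open_mball.
move=> xy; rewrite /ball_mass fine_le//; try exact: fin_num_measure.
by apply: le_measure; rewrite ?inE.
Qed.

(* If [d (x, y) < r], the [r]-ball of each point lies in the [2 r]-ball of the
   other, so that AM-GM bounds [2] by the sum of the two quotients
   [u(x) nu(B_2r(x)) / nu'(B_r(x))] and [v(y) nu'(B_2r(y)) / nu(B_r(y))];
   integrating the first one in [y] cancels its denominator, and likewise for
   the second one in [x]. The constant [e] keeps the denominators away from 0. *)
Lemma cross_mass_le (nu nu' : borel_prob R M) (r : R) (u v : borel M -> R) :
  bmf u -> bmf v -> (forall x, 0 <= u x) -> (forall x, 0 <= v x) ->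
  (forall x y : M, mdist x y < r -> 1 <= u x * v y) ->
  2 * \int[nu]_x ball_mass nu' r x <=
  \int[nu]_x (u x * ball_mass nu (2 * r) x) +
  \int[nu']_y (v y * ball_mass nu' (2 * r) y).
Proof.
move=> bu bv u0 v0 uv.
have bm n s : bmf (ball_mass n s : borel M -> R) by exact: bmf_ball_mass.
apply/ler_addgt0Pr => eps eps0.
have [u1 v1] : 0 <= \int[nu]_x u x /\ 0 <= \int[nu']_y v y.
  by split; exact: Rint_ge0.
pose T := \int[nu]_x u x + \int[nu']_y v y.
have T0 : 0 < T + 1 by rewrite /T; lra.
(* The [e] in the numerators adds [e * T] to the right-hand side, which this choice keeps below
   [eps]. *)
pose e := eps / (T + 1).
have e0 : 0 < e by rewrite divr_gt0.
have eT : e * T <= eps.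
  rewrite /e mulrAC ler_pdivrMr// ler_pM2l//; lra.
pose a n s (x : borel M) := ball_mass n s x + e.
have ba n s : bmf (a n s) by apply: bmfD => //; exact: bmf_cst.
have ae n s x : e <= a n s x by rewrite lerDr ball_mass_ge0.
have a0 n s x : 0 < a n s x by exact: lt_le_trans (ae n s x).
pose I := (\1_(close_pairs r) : _ -> R).
have bI : bmf I by exact: bmf_close_pairs.
have I0 p : 0 <= I p by rewrite /I indicE.
pose U x := u x * a nu (2 * r) x * (a nu' r x)^-1.
pose V y := v y * a nu' (2 * r) y * (a nu r y)^-1.
have bU : bmf U.
  by apply: bmfM; [exact: bmfM|exact: (bmf_inv e0 (ae _ _))].
have bV : bmf V.
  by apply: bmfM; [exact: bmfM|exact: (bmf_inv e0 (ae _ _))].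
have bF1 : bmf (fun p : borel M * borel M => U p.1 * I p).
  by apply: bmfM => //; exact: (bmf_comp measurable_fst bU).
have bF2 : bmf (fun p : borel M * borel M => V p.2 * I p).
  by apply: bmfM => //; exact: (bmf_comp measurable_snd bV).
have key p : 2 * I p <= U p.1 * I p + V p.2 * I p.
  rewrite -mulrDl /I indicE; case: (boolP (p \in _)) => [|_]; last by rewrite !mulr0.
  rewrite inE /close_pairs => /= pr; rewrite !mulr1.
  case: p pr => x y /= xyr.
  have aA : a nu' r x <= a nu' (2 * r) y.
    rewrite lerD2r; apply: ball_mass_mono => z; rewrite !ball_mdist => xz.
    have -> : 2 * r = r + r by ring.
    by apply: (mdist_lt_add (z := x)).
  have bB : a nu r y <= a nu (2 * r) x.
    rewrite lerD2r; apply: ball_mass_mono => z; rewrite !ball_mdist => yz.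
    have -> : 2 * r = r + r by ring.
    by apply: (mdist_lt_add (z := y)) => //; rewrite metric_sym.
  have U0 : 0 <= U x by rewrite /U mulr_ge0 ?mulr_ge0 ?invr_ge0 ?(ltW (a0 _ _ _)).
  have V0 : 0 <= V y by rewrite /V mulr_ge0 ?mulr_ge0 ?invr_ge0 ?(ltW (a0 _ _ _)).
  have UV : 1 <= U x * V y.
    rewrite /U /V.
    have -> : u x * a nu (2 * r) x * (a nu' r x)^-1 *
        (v y * a nu' (2 * r) y * (a nu r y)^-1) =
      (u x * v y) * ((a nu (2 * r) x / a nu r y) *
        (a nu' (2 * r) y / a nu' r x)) by ring.
    rewrite -[leLHS]mulr1 ler_pM// ?uv// -[leLHS]mulr1 ler_pM//.
      by rewrite ler_pdivlMr// mul1r.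
    by rewrite ler_pdivlMr// mul1r.
  rewrite leNgt; apply/negP => UV2; have := sqr_ge0 (U x - V y).
  have : (U x + V y) * (U x + V y) < 2 * 2 by apply: ltr_pM => //; exact: addr_ge0.
  by rewrite expr2; move: (U x) (V y) UV => s t st; nra.
have mul_a n s x : ball_mass n s x / a n s x <= 1.
  by rewrite ler_pdivrMr// mul1r /a lerDl ltW.
have I1 : \int[nu]_x \int[nu']_y (U x * I (x, y)) <=
    \int[nu]_x (u x * a nu (2 * r) x).
  apply: le_Rint; [exact: (bmf_Rint nu nu' bF1)|exact: bmfM|move=> x].
  rewrite RintZ; last exact: bmf_section bI.
  rewrite -ball_massE /U -mulrA -[leRHS]mulr1 ler_wpM2l//.
    by rewrite mulr_ge0// ltW.
  by rewrite mulrC.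
have [bG swapV] := Rint_swap nu nu' bF2.
have I2 : \int[nu]_x \int[nu']_y (V y * I (x, y)) <=
    \int[nu']_y (v y * a nu' (2 * r) y).
  rewrite swapV; apply: le_Rint; [exact: bG|exact: bmfM|move=> y /=].
  rewrite RintZ; last exact: (bmf_section y (bmf_comp (@measurable_swap _ _ _ _) bI)).
  rewrite -ball_massEl /V -mulrA -[leRHS]mulr1 ler_wpM2l//.
    by rewrite mulr_ge0// ltW.
  by rewrite mulrC.
apply: (@le_trans _ _ (\int[nu]_x (u x * a nu (2 * r) x) +
    \int[nu']_y (v y * a nu' (2 * r) y))); last first.
  rewrite /a; under eq_Rintegral do rewrite mulrDr.
  under [X in _ + X <= _]eq_Rintegral do rewrite mulrDr.
  rewrite !RintD//; try exact: bmfM; try by apply: bmfM => //; exact: bmf_cst.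
  under [X in _ + X + _ <= _]eq_Rintegral do rewrite mulrC.
  under [X in _ + (_ + X) <= _]eq_Rintegral do rewrite mulrC.
  by rewrite !RintZ//; move: eT; rewrite /T; lra.
apply: le_trans (lerD I1 I2).
rewrite -RintD; [|exact: (bmf_Rint nu nu' bF1)|exact: (bmf_Rint nu nu' bF2)].
rewrite -RintZ//; apply: le_Rint.
- exact: bmfZ.
- by apply: bmfD; [exact: (bmf_Rint nu nu' bF1)|exact: (bmf_Rint nu nu' bF2)].
move=> x; rewrite ball_massE -RintZ; last exact: bmf_section bI.
rewrite -RintD; [|exact: (bmf_section x bF1)|exact: (bmf_section x bF2)].
apply: le_Rint => [||y].
- by apply: bmfZ; exact: bmf_section bI.
- by apply: bmfD; [exact: (bmf_section x bF1)|exact: (bmf_section x bF2)].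
- exact: (key (x, y)).
Qed.

End cross_inequality.

(** * Energies *)

Section energy.
Context {R : realType} {M : pmetricType R} (cM : compact [set: M]).
Context (a : R) (a0 : 0 < a).
Implicit Types (nu rho : borel_prob R M) (N : nat).

Definition potential N nu (x : M) : R :=
  \sum_(j < N) weight a j * ball_mass nu (expR (- j%:R)) x.

Definition energy N nu : R := \int[nu]_x potential N nu x.

(** Integration of [psi] against k_N(d(x, y)) nu(dy) nu(dx), left without normalisation so that it
    stays linear in the kernel. *)
Definition energy_against N nu (psi : M -> R) : R :=
  \int[nu]_x (psi x * potential N nu x).

Definition homeo_mfun (f : homeo M) : {mfun borel M >-> borel M} :=
  mfun_Sub (mem_set (continuous_borel (@hfun_continuous _ f))).

Definition push (f : homeo M) nu : borel_prob R M :=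
  distribution nu (homeo_mfun f).

Lemma bmf_potential N nu : bmf (potential N nu : borel M -> R).
Proof. by apply: bmf_sum => j; apply: bmfZ; exact: bmf_ball_mass. Qed.

Lemma potential_ge0 N nu x : 0 <= potential N nu x.
Proof.
by apply: sumr_ge0 => j _; rewrite mulr_ge0 ?weight_ge0 ?ball_mass_ge0.
Qed.

Lemma potential_le N nu x : potential N nu x <= N%:R `^ a.
Proof.
rewrite -(sum_weight a0); apply: ler_sum => j _.
by rewrite -[leRHS]mulr1 ler_wpM2l ?weight_ge0 ?ball_mass_le1.
Qed.

Lemma energy_ge0 N nu : 0 <= energy N nu.
Proof. by apply: Rint_ge0 => x; exact: potential_ge0. Qed.

Lemma energy_le N nu : energy N nu <= N%:R `^ a.
Proof.
rewrite -[leRHS](Rint_cst nu); apply: le_Rint.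
- exact: bmf_potential.
- exact: bmf_cst.
- by move=> x; exact: potential_le.
Qed.

Lemma log_kernelE N (x y : M) :
  log_kernel a N (mdist x y) =
  \sum_(j < N) weight a j * \1_(close_pairs (expR (- j%:R))) (x, y).
Proof.
apply: eq_bigr => j _; rewrite indicE; congr (_ * (nat_of_bool _)%:R).
by apply/idP/idP; rewrite /close_pairs !inE.
Qed.

Lemma log_kernel_halfE N (x y : M) :
  log_kernel a N (mdist x y / 2) =
  \sum_(j < N) weight a j * \1_(close_pairs (2 * expR (- j%:R))) (x, y).
Proof.
apply: eq_bigr => j _; rewrite indicE; congr (_ * (nat_of_bool _)%:R).
by apply/idP/idP; rewrite /close_pairs !inE /= ltr_pdivrMr// mulrC.
Qed.

Lemma bmf_log_kernel N (x : M) :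
  bmf (fun y : borel M => log_kernel a N (mdist x (y : M))).
Proof.
rewrite (_ : (fun _ => _) = fun y : borel M =>
  \sum_(j < N) weight a j * \1_(close_pairs (expR (- j%:R))) (x, y)).
  apply: bmf_sum => j; apply: bmfZ.
  exact: (bmf_section (x : borel M) (bmf_close_pairs cM _)).
by apply/funext => y; rewrite log_kernelE.
Qed.

Lemma potentialE N nu (x : M) :
  potential N nu x = \int[nu]_y log_kernel a N (mdist x (y : M)).
Proof.
under eq_Rintegral do rewrite log_kernelE.
have b j : bmf (fun y : borel M => (\1_(close_pairs j) (x, y) : R)).
  exact: (bmf_section (x : borel M) (bmf_close_pairs cM _)).
rewrite Rint_sum => [|j]; last exact: bmfZ.
by apply: eq_bigr => j _; rewrite RintZ// ball_massE.
Qed.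

Lemma Rint_push nu (f : homeo M) (h : borel M -> R) : bmf h ->
  bmf (fun x : borel M => h (hfun f x)) /\
  \int[push f nu]_y h y = \int[nu]_x h (hfun f x).
Proof.
move=> bh; split; last by rewrite Rint_pushforward.
exact: (bmf_comp (continuous_borel (@hfun_continuous _ f)) bh).
Qed.

Lemma push_potential_double (e : R) : 0 < e -> exists2 C : R, 0 <= C &
  forall N nu (f : homeo M) (T : R) x, 0 <= T ->
    (forall x y, mdist x y <= expR T * mdist (f x) (f y)) ->
    \sum_(j < N) weight a j * ball_mass (push f nu) (2 * expR (- j%:R)) (f x) <=
    (1 + e) * potential N nu x + C * (1 + T) `^ a.
Proof.
move=> e0; have [C C0 HC] := log_kernel_slow a0 e0.
exists (C * 2 `^ a) => [|N nu f T x T0 fT]; first by rewrite mulr_ge0 ?powR_ge0.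
have bI r : bmf (fun y : borel M => (\1_(close_pairs r) (hfun f x, y) : R)).
  exact: (bmf_section (f x : borel M) (bmf_close_pairs cM _)).
have -> : \sum_(j < N) weight a j * ball_mass (push f nu) (2 * expR (- j%:R)) (f x)
   = \int[nu]_y log_kernel a N (mdist (f x) (f y) / 2).
  under eq_Rintegral do rewrite log_kernel_halfE.
  rewrite Rint_sum => [|j]; last by apply: bmfZ; exact: (Rint_push nu f (bI _)).1.
  apply: eq_bigr => j _; rewrite RintZ; last exact: (Rint_push nu f (bI _)).1.
  by rewrite ball_massE (Rint_push nu f (bI _)).2.
have bl := bmf_log_kernel N x.
rewrite potentialE -RintZ// -[X in _ <= _ + X](Rint_cst nu) -RintD//; last 2 first.
  exact: bmfZ.
  exact: bmf_cst.
apply: le_Rint.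
- rewrite (_ : (fun _ => _) = fun y : borel M => \sum_(j < N) weight a j *
    \1_(close_pairs (2 * expR (- j%:R))) (hfun f x, hfun f y)).
    by apply: bmf_sum => j; apply: bmfZ; exact: (Rint_push nu f (bI _)).1.
  by apply/funext => y; rewrite log_kernel_halfE.
- by apply: bmfD; [exact: bmfZ|exact: bmf_cst].
(* The scale shift is 1 + T because halving costs a factor 2 <= e; then (2+T)^a <= 2^a (1+T)^a
   accounts for the constant. *)
move=> y; apply: le_trans (HC N (mdist x y) _ (1 + T) _ _) _.
- lra.
- apply: le_trans (fT x y) _; rewrite expRD -mulrA [leRHS]mulrCA ler_wpM2l ?expR_ge0//.
  have := expR_ge1Dx (1 : R); have := mdist_ge0 (f x) (f y); nra.
- rewrite lerD2l -mulrA ler_wpM2l// -powRM//; last lra.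
  by rewrite ge0_ler_powR ?nnegrE ?(ltW a0)//; lra.
Qed.

Lemma Rint_convex_potential N nu (u : borel M -> R) (c : R) (s : R) :
  bmf u -> \int[nu]_x ((c + s * u x) * potential N nu x) =
    c * energy N nu + s * energy_against N nu u.
Proof.
move=> bu; have bp := bmf_potential N nu.
rewrite /energy /energy_against -!RintZ//; last exact: bmfM.
rewrite -RintD; [|exact: bmfZ|by apply: bmfZ; exact: bmfM].
by apply: eq_Rintegral => x _; ring.
Qed.

End energy.

(** * The cross inequality summed over the scales *)

Section cross_energy.
Context {R : realType} {M : pmetricType R} (cM : compact [set: M]).
Context (a : R) (a0 : 0 < a).
Implicit Types (nu rho : borel_prob R M) (N : nat).

(** [cross_mass_le] is applied at each scale to f_*nu and [rho], with the weights 1 + s psi and 1 +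
    6 eta^2 - s psi. The doubled radii that it produces are absorbed by [push_potential_double]. The
    price of the weights is of order eta^2, whereas the term in s is of order eta. *)
Lemma cross_energy_signed (e eta : R) (j0 : nat) :
  0 < e -> 0 < eta -> eta <= 1 / 4 -> exists2 C : R, 0 <= C &
  forall N nu rho (f : homeo M) (T s : R) (psi : M -> R), 0 <= T ->
    (forall x y, mdist x y <= expR T * mdist (f x) (f y)) ->
    `|s| = eta -> bmf (psi : borel M -> R) -> (forall x, `|psi x| <= 1) ->
    (forall x y, mdist x y < expR (- j0%:R) -> `|psi x - psi y| <= eta) ->
    2 * \int[nu]_x potential a N rho (hfun f x) <=
    (1 + e) * (energy a N nu + (1 + 6 * eta ^+ 2) * energy a N rho +
      s * (energy_against a N nu (psi \o f) - energy_against a N rho psi)) +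
    C * (1 + T) `^ a.
Proof.
move=> e0 eta0 eta4; have [C C0 HC] := push_potential_double cM a0 e0.
(* Both weights are at most 2, so each of the two potentials contributes an error 2 C (1+T)^a; the
   rest is the total weight of the scales j < j0. *)
exists (4 * C + 2 * j0%:R `^ a).
  by rewrite addr_ge0 ?mulr_ge0 ?powR_ge0.
move=> N nu rho f T s psi T0 fT sE bpsi psi1 osc.
have e2 : eta ^+ 2 <= 1 / 16 by rewrite expr2; nra.
have e2' : 0 <= eta ^+ 2 by exact: sqr_ge0.
pose u (x : borel M) := 1 + s * psi x.
pose v (x : borel M) := (1 + 6 * eta ^+ 2) + (- s) * psi x.
have spsi x : - eta <= s * psi x <= eta.
  by rewrite -ler_norml normrM sE -[leRHS]mulr1 ler_wpM2l// ltW.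
have ub x : 0 <= u x /\ u x <= 2 by have := spsi x; rewrite /u; lra.
have vb x : 0 <= v x /\ v x <= 2 by have := spsi x; rewrite /v; lra.
have bu : bmf u by apply: bmfD; [exact: bmf_cst|exact: bmfZ].
have bv : bmf v by apply: bmfD; [exact: bmf_cst|exact: bmfZ].
have bm n r : bmf (ball_mass n r : borel M -> R) by exact: bmf_ball_mass.
(* With p = s psi(x) and q = s psi(y), the product is 1 + 6 eta^2 + (p - q) + 6 eta^2 p - p q, whose
   last three terms are at least -eta^2, -(3/2) eta^2 and -eta^2. *)
have uv x y : mdist x y < expR (- j0%:R) -> 1 <= u x * v y.
  move=> /osc osxy; rewrite /u /v.
  have : `|s * psi x - s * psi y| <= eta * eta.
    by rewrite -mulrBr normrM sE ler_wpM2l// ltW.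
  rewrite mulNr ler_norml; have := spsi x; have := spsi y; rewrite expr2.
  move: (s * psi x) (s * psi y) => p q /andP[q1 q2] /andP[p1 p2] /andP[pq1 pq2].
  have : p * q <= eta * eta by nra.
  have : - (eta * eta) / 4 <= (eta * eta) * p by nra.
  by nra.
pose fn := push f nu.
pose L1 j := \int[fn]_x (u x * ball_mass fn (2 * expR (- j%:R)) x).
pose L2 j := \int[rho]_x (v x * ball_mass rho (2 * expR (- j%:R)) x).
have w0 := weight_ge0 a0.
have step (j : nat) : 2 * (weight a j * \int[nu]_x ball_mass rho (expR (- j%:R)) (hfun f x))
    <= weight a j * L1 j + weight a j * L2 j + 2 * (weight a j * (j < j0)%:R).
  rewrite -mulrDr !(mulrCA 2) -mulrDr ler_wpM2l//.
  have L10 : 0 <= L1 j.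
    by apply: Rint_ge0 => x; rewrite mulr_ge0 ?ball_mass_ge0//; case: (ub x).
  have L20 : 0 <= L2 j.
    by apply: Rint_ge0 => x; rewrite mulr_ge0 ?ball_mass_ge0//; case: (vb x).
  have [b1 b2] := Rint_push nu f (bm rho (expR (- j%:R))).
  (* The oscillation of [psi] is controlled only from the scale j0 on; at coarser scales masses are
     bounded by 1. *)
  case: ltnP => jj0.
    suff : \int[nu]_x ball_mass rho (expR (- j%:R)) (hfun f x) <= 1 by rewrite mulr1n; lra.
    rewrite -[leRHS](Rint_cst nu); apply: le_Rint => //; first exact: bmf_cst.
    by move=> x; exact: ball_mass_le1.
  rewrite mulr0 addr0 -b2; apply: cross_mass_le => //.
  - by move=> x; case: (ub x).
  - by move=> x; case: (vb x).
  move=> x y xy; apply: uv; apply: lt_le_trans xy _.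
  by rewrite ler_expR lerN2 ler_nat.
have S0 : 2 * \int[nu]_x potential a N rho (hfun f x) <=
    \sum_(j < N) weight a j * L1 j + \sum_(j < N) weight a j * L2 j
    + 2 * \sum_(j < N) (weight a j * (j < j0)%:R).
  rewrite /potential Rint_sum; last first.
    by move=> j; apply: bmfZ; exact: (Rint_push nu f (bm _ _)).1.
  rewrite !mulr_sumr -!big_split /=; apply: ler_sum => j _.
  by rewrite RintZ; [exact: step|exact: (Rint_push nu f (bm _ _)).1].
apply: le_trans S0 _.
have S1 : 2 * \sum_(j < N) (weight a j * (j < j0)%:R) <= 2 * j0%:R `^ a.
  by rewrite ler_wpM2l// sum_weight_le.
have T1 : 1 <= (1 + T) `^ a.
  have one : (1 : R) `^ a = 1 by rewrite powR1.
  by rewrite -[leLHS]one ge0_ler_powR ?nnegrE ?(ltW a0)//; lra.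
have bpu : bmf (fun x : borel M => u (hfun f x)) by exact: (Rint_push nu f bu).1.
have bpot n := bmf_potential cM a N n.
have S2 : \sum_(j < N) weight a j * L1 j <=
    (1 + e) * \int[nu]_x (u (hfun f x) * potential a N nu x) +
    2 * (C * (1 + T) `^ a).
  have bum j : bmf (fun x : borel M => weight a j *
      (u (hfun f x) * ball_mass fn (2 * expR (- j%:R)) (hfun f x))).
    by apply: bmfZ; apply: bmfM => //; exact: (Rint_push nu f (bm _ _)).1.
  have -> : \sum_(j < N) weight a j * L1 j = \int[nu]_x \sum_(j < N)
      weight a j * (u (hfun f x) * ball_mass fn (2 * expR (- j%:R)) (hfun f x)).
    rewrite Rint_sum => [|j]; last exact: bum.
    apply: eq_bigr => j _; rewrite RintZ.
      by rewrite /L1 (Rint_push nu f (bmfM bu (bm _ _))).2.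
    by apply: bmfM => //; exact: (Rint_push nu f (bm _ _)).1.
  rewrite -RintZ; last exact: bmfM.
  rewrite -[X in _ <= _ + X](Rint_cst nu) -RintD; last 2 first.
    by apply: bmfZ; exact: bmfM.
    exact: bmf_cst.
  apply: le_Rint.
  - by apply: bmf_sum.
  - by apply: bmfD; [apply: bmfZ; exact: bmfM|exact: bmf_cst].
  move=> x; under eq_bigr do rewrite mulrCA.
  rewrite -mulr_sumr.
  have [u0 u2] := ub (f x).
  apply: le_trans (ler_wpM2l u0 (HC N nu f T x T0 fT)) _.
  have CT : 0 <= C * (1 + T) `^ a by rewrite mulr_ge0 ?powR_ge0.
  by move: (u _) (potential _ _ _ _) (C * _) u0 u2 CT => p q r; nra.
have S3 : \sum_(j < N) weight a j * L2 j <=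
    (1 + e) * \int[rho]_x (v x * potential a N rho x) + 2 * C.
  have bvm j : bmf (fun x : borel M => weight a j *
      (v x * ball_mass rho (2 * expR (- j%:R)) x)).
    by apply: bmfZ; exact: bmfM.
  have -> : \sum_(j < N) weight a j * L2 j = \int[rho]_x \sum_(j < N)
      weight a j * (v x * ball_mass rho (2 * expR (- j%:R)) x).
    rewrite Rint_sum => [|j]; last exact: bvm.
    by apply: eq_bigr => j _; rewrite RintZ//; exact: bmfM.
  rewrite -RintZ; last exact: bmfM.
  rewrite -[X in _ <= _ + X](Rint_cst rho) -RintD; last 2 first.
    by apply: bmfZ; exact: bmfM.
    exact: bmf_cst.
  apply: le_Rint.
  - by apply: bmf_sum.
  - by apply: bmfD; [apply: bmfZ; exact: bmfM|exact: bmf_cst].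
  move=> x; under eq_bigr do rewrite mulrCA.
  rewrite -mulr_sumr.
  have [v0 v2] := vb x.
  (* For [rho] the radii are halved by the same estimate, with the identity map and T = 0. *)
  have idT (y z : M) : mdist y z <= expR 0 * mdist (homeo_id M y) (homeo_id M z).
    by rewrite expR0 mul1r.
  have Hx : \sum_(j < N) weight a j * ball_mass rho (2 * expR (- j%:R)) x <=
      (1 + e) * potential a N rho x + C.
    have := HC N rho (homeo_id M) 0 x (lexx 0) idT.
    by rewrite addr0 powR1 mulr1; apply: le_trans.
  apply: le_trans (ler_wpM2l v0 Hx) _.
  by move: (v _) (potential _ _ _ _) v0 v2 => p q; nra.
have E1 : \int[nu]_x (u (hfun f x) * potential a N nu x) =
    energy a N nu + s * energy_against a N nu (psi \o f).
  by rewrite -[X in X + _]mul1r -Rint_convex_potential//; exact: (Rint_push nu f bpsi).1.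
have E2 : \int[rho]_x (v x * potential a N rho x) =
    (1 + 6 * eta ^+ 2) * energy a N rho + (- s) * energy_against a N rho psi.
  by rewrite -Rint_convex_potential.
rewrite E1 in S2; rewrite E2 in S3.
apply: le_trans (lerD (lerD S2 S3) S1) _.
have : 2 * C <= 2 * C * (1 + T) `^ a by rewrite ler_peMr// mulr_ge0.
have : 2 * j0%:R `^ a <= 2 * j0%:R `^ a * (1 + T) `^ a.
  by rewrite ler_peMr// mulr_ge0// powR_ge0.
move: (j0%:R `^ a) ((1 + T) `^ a) (eta ^+ 2) (energy _ _ nu) (energy _ _ rho)
  (energy_against _ _ _ _) (energy_against _ _ _ _) => A B D E F G H.
by nra.
Qed.

(** The sign of s = eta or -eta is free, and the one opposite to the difference yields the absolute
    value. *)
Lemma cross_energy_le (e eta : R) (j0 : nat) :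
  0 < e -> 0 < eta -> eta <= 1 / 4 -> exists2 C : R, 0 <= C &
  forall N nu rho (f : homeo M) (T : R) (psi : M -> R), 0 <= T ->
    (forall x y, mdist x y <= expR T * mdist (f x) (f y)) ->
    bmf (psi : borel M -> R) -> (forall x, `|psi x| <= 1) ->
    (forall x y, mdist x y < expR (- j0%:R) -> `|psi x - psi y| <= eta) ->
    2 * \int[nu]_x potential a N rho (hfun f x) <=
    (1 + e) * (energy a N nu + (1 + 6 * eta ^+ 2) * energy a N rho -
      eta * `|energy_against a N nu (psi \o f) - energy_against a N rho psi|) +
    C * (1 + T) `^ a.
Proof.
move=> e0 eta0 eta4; have [C C0 HC] := cross_energy_signed j0 e0 eta0 eta4.
exists C => // N nu rho f T psi T0 fT bpsi psi1 osc.
have H s se := HC N nu rho f T s psi T0 fT se bpsi psi1 osc.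
case: (ger0P (energy_against a N nu (psi \o f) - energy_against a N rho psi)) => _.
  rewrite -mulNr; apply: H; rewrite normrN gtr0_norm//.
by rewrite mulrN opprK; apply: H; rewrite gtr0_norm.
Qed.

End cross_energy.

(** * Supports of measures on the homeomorphism group *)

Section compactness.
Context {R : realType} {M : pmetricType R} (cM : compact [set: M]).

(** Common source of the finite-cover arguments: uniform continuity, finite nets, boundedness of
    continuous functions, and the Dini argument of [outer_mean_setT]. *)
Lemma compact_eventually (P : nat -> M -> Prop) :
  (forall x, exists2 d : R, 0 < d & exists n0, forall y n,
     mdist x y < d -> (n0 <= n)%N -> P n y) ->
  exists n, forall x, P n x.
Proof.
move=> H; have : \forall n \near \oo, [set: M] `<=` P n.
  apply: (iffLR (compact_near_coveringP _) cM) => x _.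
  have [d d0 [n0 Hn0]] := H x.
  exists (ball x d, [set n | (n0 <= n)%N]) => /=.
    split; first exact: nbhsx_ballx.
    by exists n0.
  by move=> [y n] /= [xy n0n]; apply: Hn0 => //; rewrite -ball_mdist.
by move=> [n _ Hn]; exists n => x; exact: (Hn n (leqnn n) x Logic.I).
Qed.

Lemma compact_unif_continuous (V : pseudoMetricType R) (g : M -> V) (e : R) :
  continuous g -> 0 < e ->
  exists n, forall x y, mdist x y < n.+1%:R^-1 -> ball (g x) e (g y).
Proof.
move=> cg e0; apply: compact_eventually => x.
have e2 : 0 < e / 2 by lra.
have /nbhs_ballP[d /= d0 Hd] := cg x _ (nbhsx_ballx _ _ e2).
have d2 : 0 < d / 2 by lra.
exists (d / 2) => //; have [n0] := ltr_add_invr d2; rewrite add0r => n0d.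
exists n0 => y n xy n0n z yz; rewrite [e]splitr; apply: (@ball_triangle _ _ (g x)).
  by apply/ball_sym/Hd; rewrite ball_mdist; lra.
apply: Hd; rewrite ball_mdist; apply: le_lt_trans (metric_triangle x y z) _.
have : n.+1%:R^-1 <= n0.+1%:R^-1 :> R by rewrite lef_pV2 ?posrE// ler_nat.
by move: yz n0d; set p := n.+1%:R^-1; set q := n0.+1%:R^-1; lra.
Qed.

Lemma compact_finite_net (s : nat -> M) :
  (forall x (e : R), 0 < e -> exists n, mdist (s n) x < e) ->
  forall e : R, 0 < e -> exists n, forall x, exists2 i, (i < n)%N & mdist (s i) x < e.
Proof.
move=> ds e e0; apply: compact_eventually => x.
have e2 : 0 < e / 2 by lra.
exists (e / 2) => //; have [i six] := ds x _ e2.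
exists i.+1 => y n xy i_n; exists i => //.
by apply: le_lt_trans (metric_triangle _ x _) _; lra.
Qed.

Lemma homeo_open_ball (U : set (homeo M)) f : open U -> U f ->
  exists2 e : R, 0 < e & forall g : homeo M, (forall x, mdist (f x) (g x) < e) -> U g.
Proof.
move=> [A oA <-] /= Af.
have /uniform_nbhs[E [entE HE]] : nbhs (hfun f : {uniform M -> M}) A.
  exact: open_nbhs_nbhs.
move: entE; rewrite -entourage_ballE => -[e /= e0 eE].
exists e => // g fg; apply: HE => x _; apply: eE => /=.
by rewrite ball_mdist.
Qed.

(* The code of [f] records a modulus of continuity and the approximate values
   of [f] on the finite net that this modulus requires. *)
Lemma homeo_countable_partition (e : R) : 0 < e ->
  exists c : homeo M -> nat, forall f g, c f = c g -> forall x, mdist (f x) (g x) < e.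
Proof.
move=> e0; have [s ds] := compact_dense_sequence cM.
have e4 : 0 < e / 4 by lra.
have net := compact_finite_net ds.
have /choice[N HN] (k : nat) : exists n, forall x,
    exists2 i, (i < n)%N & mdist (s i) x < k.+1%:R^-1 by exact: net.
have /choice[K HK] (f : homeo M) := compact_unif_continuous (@hfun_continuous _ f) e4.
have /choice[p Hp] (x : M) := ds x _ e4.
exists (fun f => pickle (K f, [seq p (f (s i)) | i <- iota 0 (N (K f))])).
move=> f g /(pcan_inj (@pickleK _)) [Kfg].
rewrite -Kfg => /eq_in_map pfg x.
have [i iN six] := HN (K f) x.
have pE : p (f (s i)) = p (g (s i)) by apply: pfg; rewrite mem_iota.
have := HK f _ _ six; have sixg := six; rewrite Kfg in sixg.
have := HK g _ _ sixg; rewrite !ball_mdist => fgx ffx.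
have := Hp (f (s i)); have := Hp (g (s i)); rewrite -pE => pg pf.
have := metric_triangle (f x) (f (s i)) (g x).
have := metric_triangle (f (s i)) (s (p (f (s i)))) (g x).
have := metric_triangle (s (p (f (s i)))) (g (s i)) (g x).
rewrite (metric_sym (f x) (f (s i))) (metric_sym (f (s i)) (s _)).
by lra.
Qed.

(** A Lindelof argument: a point outside the support has a null open neighbourhood, which contains
    the point's cell in one of countably many countable partitions. [F m k] is a null open set
    containing the cell k of the partition m, or the empty set if there is none; countably many null
    sets thus cover the complement. *)
Lemma supp_full (mu : borel_prob R (homeo M)) : mu.-negligible (~` supp mu).
Proof.
have npos m : 0 < m.+1%:R^-1 :> R by [].
have /choice[c Hc] m := homeo_countable_partition (npos m).
pose null (O : set (homeo M)) := open O /\ mu O = 0%E.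
pose F m k := xget (set0 : set (homeo M)) [set O | null O /\ [set f | c m f = k] `<=` O].
have F0 m k : null (F m k).
  rewrite /F; case: xgetP => [W -> [nW _]|_]; first exact: nW.
  by split; [exact: open0|exact: measure0].
have [A [mA A0 FA]] :
    mu.-negligible (\bigcup_m \bigcup_k F m k : set (borel (homeo M))).
  apply: negligible_bigcup => m; apply: negligible_bigcup => k.
  by have [oF F0'] := F0 m k; apply/negligibleP => //; exact: open_borel.
exists A; split => //; apply: subset_trans FA.
move=> f /existsNP[U /not_implyP[oU /not_implyP[Uf /negP]]].
rewrite -leNgt measure_le0 => /eqP muU.
have [m Hm] : exists m, [set g | c m g = c m f] `<=` U.
  have [e e0 He] := homeo_open_ball oU Uf.
  have [m] := ltr_add_invr e0; rewrite add0r => me.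
  exists m => g cgf; apply: He => x.
  by apply: lt_trans me; exact: Hc.
exists m => //; exists (c m f) => //.
rewrite /F; case: xgetP => [W _ [_]|]; first exact.
by move=> /(_ U) []; split.
Qed.

End compactness.

(** * Moments *)

Section moments.
Context {R : realType}.

(* No measurability is needed, as the integral of a nonnegative function is a
   supremum over the simple functions below it; [bilip_const] is thus never
   shown to be measurable. *)
Lemma ge0_le_integral_any d (T : measurableType d)
    (mu : {measure set T -> \bar R}) (f g : T -> \bar R) :
  (forall x, 0 <= f x)%E -> (forall x, f x <= g x)%E ->
  (\int[mu]_x f x <= \int[mu]_x g x)%E.
Proof.
move=> f0 fg; have g0 x : (0 <= g x)%E by exact: le_trans (f0 x) (fg x).
rewrite !ge0_integralTE//; apply: le_ereal_sup => _ [h hf <-].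
by exists h => // x; exact: le_trans (hf x) (fg x).
Qed.

Context {M : pmetricType R} (cM : compact [set: M]).

Lemma supp_closed (mu : borel_prob R (homeo M)) : closed (supp mu).
Proof.
rewrite -openC openE => f /existsNP[U /not_implyP[oU /not_implyP[Uf nU]]].
have : nbhs f U by exact: open_nbhs_nbhs.
by apply: filterS => g Ug /(_ U oU Ug).
Qed.

Definition log_lip (f : homeo M) : R := ln (fine (bilip_const f)).

Lemma bilipschitz_stretch (f : homeo M) : bilipschitz f ->
  0 <= log_lip f /\
  forall x y, mdist x y <= expR (log_lip f) * mdist (f x) (f y).
Proof.
(* On a one-point space the suprema are over the empty set, hence equal to -oo, which [fine] and
   then [ln] send to 0. *)
move=> [k Hk]; have [[p [q pq]]|same] := pselect (exists p q : M, p != q); last first.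
  have e x y : x = y :> M.
    by apply: contrapT => /eqP xy; apply: same; exists x, y.
  split => [|x y]; last by rewrite (e x y) mdistxx mulr_ge0 ?expR_ge0 ?mdist_ge0.
  rewrite /log_lip /bilip_const.
  suff lipE (h : M -> M) : lip_const h = (-oo)%E by rewrite !lipE maxxx /= ln0.
  rewrite /lip_const; set A := (X in ereal_sup X).
  suff -> : A = set0 by rewrite ereal_sup0.
  by rewrite -subset0 => _ [[x y] /= xy _]; rewrite (e x y) eqxx in xy.
have inj x y : x != y -> f x != f y.
  by apply: contra_neq => /(congr1 (hinv f)); rewrite !hfunK.
have ratio (x y : M) : x != y ->
    ((mdist (f x) (f y) / mdist x y)%:E <= bilip_const f)%E /\
    ((mdist x y / mdist (f x) (f y))%:E <= bilip_const f)%E.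
  move=> xy; rewrite /bilip_const !le_max; split; apply/orP; [left|right].
    by apply: ereal_sup_ubound; exists (x, y).
  apply: ereal_sup_ubound; exists (f x, f y) => /=; first exact: inj.
  by rewrite !hfunK.
have le_k : (bilip_const f <= k%:E)%E.
  rewrite /bilip_const ge_max; apply/andP; split; apply: ge_ereal_sup => _ [[x y] /= xy <-].
    rewrite lee_fin ler_pdivrMr ?mdist_gt0//; exact: (Hk x y).1.
  rewrite lee_fin ler_pdivrMr ?mdist_gt0//; exact: (Hk x y).2.
pose L := fine (bilip_const f).
have LE : bilip_const f = L%:E.
  rewrite fineK// fin_real//; apply/andP; split.
    by apply: lt_le_trans (ratio _ _ pq).1; rewrite ltNyr.
  by apply: le_lt_trans le_k _; rewrite ltry.
(* L dominates both the ratio for the pair p, q and its inverse. *)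
have L1 : 1 <= L.
  have := ratio _ _ pq; rewrite LE !lee_fin.
  have : 0 < mdist p q by rewrite mdist_gt0.
  have : 0 < mdist (f p) (f q) by rewrite mdist_gt0 inj.
  move: (mdist p q) (mdist (f p) (f q)) => u v v0 u0 [].
  rewrite !ler_pdivrMr// => vu uv; nra.
have L0 : 0 < L by lra.
rewrite /log_lip -/L; split => [|x y]; first exact: ln_ge0.
rewrite lnK ?posrE//.
have [->|xy] := eqVneq x y; first by rewrite !mdistxx mulr0.
by have := (ratio _ _ xy).2; rewrite LE lee_fin ler_pdivrMr// mdist_gt0 inj.
Qed.

(** On the support, which has full measure, h / C - 1 is at most the integrand of the moment. Its
    positive part is a measurable function below that integrand, so its integral is at most [C0]. *)
Lemma moment_le (a C0 C : R) (mu : borel_prob R (homeo M))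
    (h : borel (homeo M) -> R) :
  0 < a -> 0 < C -> supp mu `<=` @bilipschitz R M ->
  (\int[mu]_(f in @bilipschitz R M) (log_lip f `^ a)%:E <= C0%:E)%E ->
  bmf h -> (forall f : homeo M, bilipschitz f -> h f <= C * (1 + log_lip f `^ a)) ->
  \int[mu]_f h f <= C * (1 + C0).
Proof.
move=> a0 C_gt0 subK mom bh hC.
pose S : set (borel (homeo M)) := supp mu.
have mS : measurable S by apply: closed_borel; exact: supp_closed.
have [B hB] := bh.2.
pose k f := C^-1 * h f - 1.
have bk : bmf k by apply: bmfB; [exact: bmfZ|exact: bmf_cst].
(* The positive part of [k], cut off outside the support. *)
pose h' f := \1_S f * (2^-1 * (k f + `|k f|)).
have bh' : bmf h'.
  by apply: bmfM; [exact: bmf_indic|apply: bmfZ; apply: bmfD => //; exact: bmf_norm].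
have h'0 f : 0 <= h' f.
  rewrite /h' mulr_ge0 ?indicE// mulr_ge0 ?invr_ge0//.
  by case: (ger0P (k f)) => kf; lra.
have h'C : \int[mu]_f h' f <= C0.
  rewrite -lee_fin EFin_Rint//; apply: le_trans mom.
  rewrite [leRHS]integral_mkcond; apply: ge0_le_integral_any => f; rewrite ?lee_fin//.
  rewrite /h' indicE patchE; case: (boolP (f \in S)) => fS; last first.
    by rewrite mul0r; case: ifP => // _; rewrite lee_fin powR_ge0.
  have bf : bilipschitz (f : homeo M) by apply: subK; exact: set_mem fS.
  rewrite ifT; last exact: mem_set.
  rewrite mul1r lee_fin; have := hC _ bf; rewrite -ler_pdivrMl// => kf.
  have T0 := powR_ge0 (log_lip f) a.
  have : k f <= log_lip f `^ a by rewrite /k; lra.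
  by case: (ger0P (k f)) => _; lra.
have le1 f : h f <= C * (1 + h' f) + B * \1_(~` S) f.
  have := hB f; rewrite ler_norml => /andP[_ hBf].
  rewrite /h' !indicE in_setC; case: (boolP (f \in S)) => fS /=; last first.
    by rewrite mul0r addr0 !mulr1; lra.
  rewrite mulr0 addr0 mul1r -ler_pdivrMl// addrC -lerBlDr.
  by rewrite -/(k f); have := ler_norm (k f); lra.
have b1 : bmf (fun f => C * (1 + h' f)).
  by apply: bmfZ; apply: bmfD => //; exact: bmf_cst.
have b2 : bmf (\1_(~` S) : borel (homeo M) -> R).
  by apply: bmf_indic; exact: measurableC.
apply: le_trans (le_Rint mu bh (bmfD b1 (bmfZ B b2)) le1) _.
rewrite RintD//; last exact: bmfZ.
rewrite !RintZ//; last by apply: bmfD => //; exact: bmf_cst.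
rewrite RintD//; last exact: bmf_cst.
rewrite Rint_cst Rint_indic; last exact: measurableC.
have [N [mN N0 SN]] := supp_full cM mu.
have -> : mu (~` S) = 0%E.
  by apply: subset_measure0 SN _ => //; exact: measurableC.
by rewrite mulr0 addr0 ler_pM2l// lerD2l.
Qed.

End moments.

(** * The energy inequality averaged over mu *)

Section averaged_inequality.
Context {R : realType} {M : pmetricType R} (cM : compact [set: M]).
Context (a C0 : R) (a0 : 0 < a).

Definition bounded_moment (mu : borel_prob R (homeo M)) :=
  supp mu `<=` @bilipschitz R M /\
  (\int[mu]_(f in @bilipschitz R M) (log_lip f `^ a)%:E <= C0%:E)%E.

(** The convolution is tested on functions rather than on sets; measurability of the inner integral
    in f is included because linearity of the outer one requires it. *)
Definition is_convolution (mu : borel_prob R (homeo M))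
    (nu rho : borel_prob R M) :=
  forall h : borel M -> R, bmf h ->
    bmf (fun f : borel (homeo M) => \int[nu]_x h (hfun f x)) /\
    \int[rho]_y h y = \int[mu]_f \int[nu]_x h (hfun f x).

Lemma bmf_continuous (psi : M -> R) :
  continuous psi -> bmf (psi : borel M -> R).
Proof.
move=> cpsi; split; first exact: continuous_borel_real.
have [B HB] : exists n : nat, forall x, `|psi x| <= n%:R.
  apply: (compact_eventually cM) => x.
  have /nbhs_ballP[d /= d0 Hd] := cpsi x _ (nbhsx_ballx _ _ (@ltr01 R)).
  exists d => //; exists (Num.trunc (`|psi x| + 1)).+1 => y n xy n0n.
  have : ball (psi x) 1 (psi y) by apply: Hd; rewrite ball_mdist.
  rewrite /ball /= => xy1.
  have : `|psi y| <= `|psi x| + `|psi x - psi y|.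
    by have := ler_normB (psi x) (psi x - psi y); rewrite subKr.
  have := truncnS_gt (`|psi x| + 1); rewrite -(ler_nat R) in n0n.
  by move: n0n xy1; lra.
by exists B%:R.
Qed.

Lemma bmf_energy_against N (nu : borel_prob R M) (psi : M -> R) :
  bmf (psi : borel M -> R) ->
  bmf (fun f : borel (homeo M) => energy_against a N nu (psi \o (f : homeo M))).
Proof.
move=> bpsi.
pose F (p : borel (homeo M) * borel M) :=
  psi ((p.1 : homeo M) p.2) * potential a N nu p.2.
have bF : bmf F.
  apply: bmfM; first exact: (bmf_comp (measurable_eval cM) bpsi).
  exact: (bmf_comp measurable_snd (bmf_potential cM a N nu)).
(* Measurability of the partial integral comes from Fubini, which needs some probability on the
   first factor. *)
have mu0 : borel_prob R (homeo M) := dirac (point : borel (homeo M)).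
exact: (bmf_Rint mu0 nu bF).
Qed.

(** [cross_energy_le] is integrated in f, with T = [log_lip f]. Since [rho] is the convolution, the
    average of the cross energies is the energy of [rho] itself, and the moment condition bounds the
    average of the errors. *)
Lemma averaged_inequality (e eta : R) (j0 : nat) :
  0 < e -> 0 < eta -> eta <= 1 / 4 -> exists2 C : R, 0 <= C &
  forall N mu nu rho (psi : M -> R), bounded_moment mu ->
    is_convolution mu nu rho ->
    bmf (psi : borel M -> R) -> (forall x, `|psi x| <= 1) ->
    (forall x y, mdist x y < expR (- j0%:R) -> `|psi x - psi y| <= eta) ->
    2 * energy a N rho <=
    (1 + e) * (energy a N nu + (1 + 6 * eta ^+ 2) * energy a N rho -
      eta * \int[mu]_f `|energy_against a N nu (psi \o (f : homeo M)) -
                        energy_against a N rho psi|) + C.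
Proof.
move=> e0 eta0 eta4.
have [C1 C10 HC1] := cross_energy_le cM a0 j0 e0 eta0 eta4.
have [C2 C20 HC2] := powR_slow a0 (@ltr01 R).
(* From (1+T)^a <= 2 + C2 T^a, the error C1 (1+T)^a is at most C1 (2+C2) (1+T^a); the final 1 makes
   [C] positive. The absolute value below is there because [C0] has no prescribed sign. *)
pose C := C1 * (2 + C2) + 1.
have C_gt0 : 0 < C by rewrite /C; nra.
exists `|C * (1 + C0)| => [//|N mu nu rho psi [suppB mom] conv bpsi psi1 osc].
have bpot := bmf_potential cM a N rho.
have [bc cE] := conv _ bpot.
pose D f := `|energy_against a N nu (psi \o (f : homeo M)) -
              energy_against a N rho psi|.
have bD : bmf (D : borel (homeo M) -> R).
  apply: bmf_norm; apply: bmfB; last exact: bmf_cst.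
  exact: bmf_energy_against.
pose k := energy a N nu + (1 + 6 * eta ^+ 2) * energy a N rho.
pose h (f : borel (homeo M)) := 2 * \int[nu]_x potential a N rho (hfun f x)
   + ((1 + e) * eta * D f - (1 + e) * k).
have b1 := bmfZ 2 bc.
have b2 := bmfZ ((1 + e) * eta) bD.
have b3 := bmf_cst (borel (homeo M)) ((1 + e) * k).
have bh : bmf h by apply: bmfD => //; exact: bmfB.
have hC f : bilipschitz f -> h f <= C * (1 + log_lip f `^ a).
  move=> bf; have [T0 fT] := bilipschitz_stretch bf.
  have := HC1 N nu rho f (log_lip f) psi T0 fT bpsi psi1 osc.
  have := HC2 1 (log_lip f) ler01 T0; rewrite powR1 -/(D f).
  have := powR_ge0 (log_lip f) a.
  rewrite /h -/(D f) /k; move: (D f) ((1 + log_lip f) `^ a) (log_lip f `^ a).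
  move=> u v w w0 vw.
  have : C1 * v <= C * (1 + w).
    apply: (@le_trans _ _ (C1 * ((2 + C2) * (1 + w)))).
      rewrite ler_wpM2l//; nra.
    by rewrite mulrA ler_wpM2r//; [lra|rewrite /C; lra].
  by lra.
have := moment_le cM a0 C_gt0 suppB mom bh hC.
rewrite RintD//; last exact: bmfB.
rewrite RintB// Rint_cst !RintZ// -cE -/(energy a N rho) => H.
have := ler_norm (C * (1 + C0)); rewrite /k in H; rewrite -/D.
by move: H; lra.
Qed.

End averaged_inequality.

(** * Measures from positive functionals *)

Section riesz.
Context {R : realType} {M : pmetricType R} (cM : compact [set: M]).

Section continuous_functions.
Implicit Types phi psi : M -> R.

Lemma cont_cst (c : R) : continuous (fun _ : M => c).
Proof. by move=> x; exact: cvg_cst. Qed.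

Lemma contD phi psi : continuous phi -> continuous psi ->
  continuous (fun x => phi x + psi x).
Proof. by move=> cphi cpsi x; apply: cvgD; [exact: cphi|exact: cpsi]. Qed.

Lemma contM phi psi : continuous phi -> continuous psi ->
  continuous (fun x => phi x * psi x).
Proof. by move=> cphi cpsi x; apply: cvgM; [exact: cphi|exact: cpsi]. Qed.

Lemma contB phi psi : continuous phi -> continuous psi ->
  continuous (fun x => phi x - psi x).
Proof. by move=> cphi cpsi x; apply: cvgB; [exact: cphi|exact: cpsi]. Qed.

Lemma cont_sum n (F : nat -> M -> R) : (forall i, continuous (F i)) ->
  continuous (fun x => \sum_(i < n) F i x).
Proof.
move=> cF; elim: n => [|n ih].
  by under eq_fun do rewrite big_ord0; exact: cont_cst.
by under eq_fun do rewrite big_ord_recr/=; exact: contD.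
Qed.

Lemma lipschitz_cont phi (c : R) :
  0 <= c -> (forall x y, `|phi x - phi y| <= c * mdist x y) -> continuous phi.
Proof.
move=> c0 H x; apply/cvgrPdist_lt => e e0; apply/nbhs_ballP.
have c1 : 0 < c + 1 by lra.
exists (e / (c + 1)) => /=; first by rewrite divr_gt0.
move=> y; rewrite ball_mdist ltr_pdivlMr// => xy.
by have := H x y; have := mdist_ge0 x y; nra.
Qed.

End continuous_functions.

(* Increases, as [k] grows, to the indicator of the ball. *)
Definition ball_bump (z : M) (r : R) (k : nat) (x : M) : R :=
  Num.min 1 (k%:R * Num.max 0 (r - mdist z x)).

Lemma ball_bump01 z r k x : 0 <= ball_bump z r k x <= 1.
Proof.
have m0 : 0 <= Num.max 0 (r - mdist z x) by rewrite le_max lexx.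
by rewrite /ball_bump le_min ler01 mulr_ge0//= ge_min lexx.
Qed.

Lemma ball_bump_nd z r k x : ball_bump z r k x <= ball_bump z r k.+1 x.
Proof.
have m0 : 0 <= Num.max 0 (r - mdist z x) by rewrite le_max lexx.
rewrite /ball_bump le_min ge_min lexx /= ge_min; apply/orP; right.
by rewrite ler_wpM2r// ler_nat.
Qed.

Lemma ball_bump_out z r k x : ~ ball z r x -> ball_bump z r k x = 0.
Proof.
rewrite ball_mdist => /negP; rewrite -leNgt => zx; rewrite /ball_bump.
by rewrite (max_idPl _) ?subr_le0// mulr0 (min_idPr _).
Qed.

Lemma ball_bump_in z r x : ball z r x -> exists k, ball_bump z r k x = 1.
Proof.
rewrite ball_mdist -subr_gt0 => zx; have [k] := ltr_add_invr zx.
rewrite add0r => kr; exists k.+1; rewrite /ball_bump (max_idPr (ltW zx)).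
by apply/min_idPl; rewrite -ler_pdivrMl// mulr1 ltW.
Qed.

Lemma ball_bump_cont z r k : continuous (ball_bump z r k).
Proof.
apply: (@lipschitz_cont _ k%:R) => // x y; rewrite /ball_bump.
set p := Num.max 0 (r - mdist z x); set q := Num.max 0 (r - mdist z y).
have pq : `|p - q| <= mdist x y.
  have := metric_triangle z x y; have := metric_triangle z y x.
  rewrite (metric_sym y x) ler_norml /p /q.
  move: (mdist z x) (mdist z y) (mdist x y) => u v w.
  by case: (leP 0 (r - u)); case: (leP 0 (r - v)) => *; apply/andP; split; lra.
apply: (@le_trans _ _ `|k%:R * p - k%:R * q|); last first.
  by rewrite -mulrBr normrM ger0_norm// ler_wpM2l.
move: (k%:R * p) (k%:R * q) => u v; rewrite ler_norml.
have := ler_norm (u - v); have := ler_norm (v - u); rewrite (distrC v).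
by case: (leP 1 u); case: (leP 1 v) => *; apply/andP; split; lra.
Qed.

(** The normalised positive linear functionals on C(M); the values of [L] on discontinuous functions
    are unconstrained. *)
Record mean (L : (M -> R) -> R) : Prop := Mean {
  mean_mono : forall phi psi : M -> R, continuous phi -> continuous psi ->
    (forall x, phi x <= psi x) -> L phi <= L psi;
  meanD : forall phi psi : M -> R, continuous phi -> continuous psi ->
    L (fun x => phi x + psi x) = L phi + L psi;
  meanZ : forall (c : R) (phi : M -> R), continuous phi -> L (fun x => c * phi x) = c * L phi;
  mean1 : L (fun=> 1) = 1 }.

(* Increasing limits of continuous functions are the lower semicontinuous
   functions, and those dominating the indicator of [A] compute the outer
   measure of [A]. *)
Record majorant (L : (M -> R) -> R) (A : set M) (g : nat -> M -> R) (c : R) :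
    Prop := Majorant {
  maj_cont : forall n, continuous (g n);
  maj_ge0 : forall n x, 0 <= g n x;
  maj_nd : forall n x, g n x <= g n.+1 x;
  maj_sup : forall x, A x -> forall t, t < 1 -> exists n, t < g n x;
  maj_le : forall n, L (g n) <= c }.

Definition outer_mean (L : (M -> R) -> R) (A : set M) : R :=
  inf [set c | exists g, majorant L A g c].

Section outer_measure.
Implicit Types phi psi : M -> R.
Context (L : (M -> R) -> R) (Lm : mean L).

Lemma mean_cst (c : R) : L (fun=> c) = c.
Proof.
have -> : (fun _ : M => c) = (fun=> c * 1) by rewrite mulr1.
by rewrite (meanZ Lm) ?(mean1 Lm) ?mulr1//; exact: cont_cst.
Qed.

Lemma mean_ge0 phi : continuous phi -> (forall x, 0 <= phi x) -> 0 <= L phi.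
Proof.
by move=> cphi phi0; rewrite -(mean_cst 0); apply: (mean_mono Lm) => //; exact: cont_cst.
Qed.

Lemma meanB phi psi : continuous phi -> continuous psi ->
  L (fun x => phi x - psi x) = L phi - L psi.
Proof.
move=> cphi cpsi; under eq_fun do rewrite -mulN1r.
rewrite (meanD Lm)// ?(meanZ Lm)// ?mulN1r//.
by apply: contM => //; exact: cont_cst.
Qed.

Lemma mean_sum n (F : nat -> M -> R) : (forall i, continuous (F i)) ->
  L (fun x => \sum_(i < n) F i x) = \sum_(i < n) L (F i).
Proof.
move=> cF; elim: n => [|n ih].
  by under eq_fun do rewrite big_ord0; rewrite big_ord0 mean_cst.
under eq_fun do rewrite big_ord_recr/=.
by rewrite big_ord_recr/= (meanD Lm)// ?ih//; exact: cont_sum.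
Qed.

Lemma maj_mono A g c : majorant L A g c ->
  forall n m x, (n <= m)%N -> g n x <= g m x.
Proof.
move=> Hg n m x nm; have : nondecreasing_seq (g ^~ x).
  by apply/nondecreasing_seqP => k; exact: (maj_nd Hg).
by move=> H; exact: H.
Qed.

Lemma maj_c_ge0 A g c : majorant L A g c -> 0 <= c.
Proof.
move=> Hg; apply: le_trans (maj_le Hg 0).
by apply: mean_ge0; [exact: (maj_cont Hg)|exact: (maj_ge0 Hg)].
Qed.

Lemma outer_mean_has_inf A : has_inf [set c | exists g, majorant L A g c].
Proof.
split; last by exists 0 => c [g Hg]; exact: maj_c_ge0 Hg.
exists 1, (fun _ _ => 1); split => // [n|x _ t t1|n]; first exact: cont_cst.
  by exists 0%N.
by rewrite mean_cst.
Qed.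

Lemma outer_mean_le A g c : majorant L A g c -> outer_mean L A <= c.
Proof.
by move=> Hg; apply: ge_inf; [exact: (outer_mean_has_inf A).2|exists g].
Qed.

Lemma outer_mean_adherent A (e : R) : 0 < e ->
  exists g c, majorant L A g c /\ c < outer_mean L A + e.
Proof.
move=> /inf_adherent/(_ (outer_mean_has_inf A))[c [g Hg] cA].
by exists g, c.
Qed.

Lemma outer_mean_ge0 A : 0 <= outer_mean L A.
Proof.
apply: lb_le_inf; first exact: (outer_mean_has_inf A).1.
by move=> c [g Hg]; exact: maj_c_ge0 Hg.
Qed.

Lemma outer_mean0 : outer_mean L set0 = 0.
Proof.
apply/eqP; rewrite eq_le outer_mean_ge0 andbT.
apply: (@outer_mean_le _ (fun _ _ => 0)); split => // [n|n]; first exact: cont_cst.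
by rewrite mean_cst.
Qed.

Lemma le_outer_mean A B : A `<=` B -> outer_mean L A <= outer_mean L B.
Proof.
move=> AB; apply: lb_le_inf; first exact: (outer_mean_has_inf B).1.
move=> c [g Hg]; apply: (@outer_mean_le _ g); split; try by case: Hg.
by move=> x /AB; exact: (maj_sup Hg).
Qed.

(** Dini: an increasing sequence of continuous functions that passes 1 - e at every point does so
    uniformly from some index on, whence c >= 1 - e for every majorant. *)
Lemma outer_mean_setT : outer_mean L setT = 1.
Proof.
apply/eqP; rewrite eq_le; apply/andP; split.
  apply: (@outer_mean_le _ (fun _ _ => 1)); split => // [n|x _ t t1|n].
  - exact: cont_cst.
  - by exists 0%N.
  - by rewrite mean_cst.
apply: lb_le_inf; first exact: (outer_mean_has_inf _).1.
move=> c [g Hg]; apply/ler_addgt0Pr => e e0.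
have [n Hn] : exists n, forall x, 1 - e <= g n x.
  apply: (compact_eventually cM) => x.
  have [n gn] := maj_sup Hg (x := x) Logic.I (t := 1 - e) (ltac:(lra)).
  have gne : 0 < g n x - (1 - e) by lra.
  have cg : continuous (g n) by exact: (maj_cont Hg).
  have /nbhs_ballP[d /= d0 Hd] := cg x _ (nbhsx_ballx _ _ gne).
  exists d => //; exists n => y m xy nm.
  apply: le_trans (maj_mono Hg y nm).
  have : ball (g n x) (g n x - (1 - e)) (g n y) by apply: Hd; rewrite ball_mdist.
  by rewrite /ball /= => ?; have := ler_norm (g n x - g n y); lra.
have := maj_le Hg n; have : L (fun=> 1 - e) <= L (g n).
  by apply: (mean_mono Lm) => //; [exact: cont_cst|exact: (maj_cont Hg)].
by rewrite mean_cst; lra.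
Qed.

(** Majorants of the [F i], with errors e / 2^(i+1), are combined diagonally: the n-th function is
    the sum of the n-th functions of the first n of them. *)
Lemma outer_mean_bigcup (F : nat -> set M) (s : R) :
  (forall n, \sum_(i < n) outer_mean L (F i) <= s) ->
  outer_mean L (\bigcup_i F i) <= s.
Proof.
move=> Fs; apply/ler_addgt0Pr => e e0.
have eps i : 0 < e / 2 ^+ i.+1 by rewrite divr_gt0// exprn_gt0.
have /choice[g /choice[c Hgc]] i := outer_mean_adherent (F i) (eps i).
have Hg i : majorant L (F i) (g i) (c i) := (Hgc i).1.
have cg i n : continuous (g i n) by exact: (maj_cont (Hg i)).
have geo n : \sum_(i < n) (e / 2 ^+ i.+1) = e - e / 2 ^+ n.
  elim: n => [|n ih]; first by rewrite big_ord0 expr0 divr1 subrr.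
  rewrite big_ord_recr/= ih exprS invfM; set q := (2 ^+ n)^-1; lra.
apply: (@outer_mean_le _ (fun n x => \sum_(i < n) g i n x)); split.
- by move=> n; exact: (@cont_sum n (fun i => g i n)).
- by move=> n x; apply: sumr_ge0 => i _; exact: (maj_ge0 (Hg i)).
- move=> n x; rewrite big_ord_recr/=; apply: ler_wpDr.
    exact: (maj_ge0 (Hg n)).
  by apply: ler_sum => i _; exact: (maj_nd (Hg i)).
- move=> x [i _ Fx] t /(maj_sup (Hg i) Fx)[n tn].
  exists (maxn n i.+1); apply: (lt_le_trans tn).
  apply: le_trans (maj_mono (Hg i) x (leq_maxl n i.+1)) _.
  have im : (i < maxn n i.+1)%N by exact: leq_maxr.
  rewrite (bigD1 (Ordinal im))//= lerDl; apply: sumr_ge0 => j _.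
  exact: (maj_ge0 (Hg j)).
- move=> n; rewrite (@mean_sum n (fun i => g i n))//.
  apply: (@le_trans _ _ (\sum_(i < n) (outer_mean L (F i) + e / 2 ^+ i.+1))).
    apply: ler_sum => i _; apply: le_trans (maj_le (Hg i) n) _.
    exact/ltW/(Hgc i).2.
  rewrite big_split/=; apply: lerD; first exact: Fs.
  rewrite geo gerBl.
  by rewrite divr_ge0 ?(ltW e0)// exprn_ge0.
Qed.

(** This is the Caratheodory inequality. A majorant g of A is cut by the bumps chi_n increasing to
    the indicator of the ball: g_n chi_n serves inside the ball, with means tending to their
    supremum s, and g_n (1 - chi_N) serves outside, for a fixed N at which the mean is within e/2 of
    s. *)
Lemma outer_mean_ball (z : M) (r : R) (A : set M) :
  outer_mean L (A `&` ball z r) + outer_mean L (A `&` ~` ball z r) <=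
  outer_mean L A.
Proof.
apply/ler_addgt0Pr => e e0; have e2 : 0 < e / 2 by lra.
have [g [c [Hg cA]]] := outer_mean_adherent A e2.
pose chi := ball_bump z r.
have chi0 k x : 0 <= chi k x by have /andP[] := ball_bump01 z r k x.
have chi1 k x : chi k x <= 1 by have /andP[] := ball_bump01 z r k x.
have cchi k : continuous (chi k) by exact: ball_bump_cont.
have chi_nd n m x : (n <= m)%N -> chi n x <= chi m x.
  move=> nm; have : nondecreasing_seq (chi ^~ x).
    by apply/nondecreasing_seqP => k; exact: ball_bump_nd.
  by move=> H; exact: H.
have cg n : continuous (g n) by exact: (maj_cont Hg).
have g0 n x : 0 <= g n x by exact: (maj_ge0 Hg).
pose b n := L (fun x => g n x * chi n x).
have gc n k : continuous (fun x => g n x * chi k x) by exact: contM.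
have bc n : b n <= c.
  apply: le_trans (maj_le Hg n); apply: (mean_mono Lm) => // x.
  by rewrite -[leRHS]mulr1 ler_wpM2l.
pose s := sup (range b).
have hs : has_sup (range b).
  by split; [exists (b 0%N), 0%N|exists c => _ [n _ <-]].
have [_ [N _ <-] bN] := sup_adherent e2 hs.
have in_le : outer_mean L (A `&` ball z r) <= s.
  apply: (@outer_mean_le _ (fun n x => g n x * chi n x)); split => //.
  - by move=> n x; rewrite mulr_ge0.
  - move=> n x; apply: ler_pM => //; first exact: (maj_nd Hg).
    exact: ball_bump_nd.
  - move=> x [Ax zx] t t1; have [n tn] := maj_sup Hg Ax t1.
    have [k kx] := ball_bump_in zx; exists (maxn n k).
    have -> : chi (maxn n k) x = 1.
      apply/eqP; rewrite eq_le chi1 -kx; apply: chi_nd; exact: leq_maxr.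
    by rewrite mulr1 (lt_le_trans tn)// (maj_mono Hg)// leq_maxl.
  - by move=> n; apply: ub_le_sup; [exact: hs.2|exists n].
have out_le : outer_mean L (A `&` ~` ball z r) <= c - s + e / 2.
  have mono n m : (n <= m)%N -> L (fun x => g n x - g n x * chi N x) <=
      L (fun x => g m x - g m x * chi N x).
    move=> nm; apply: (mean_mono Lm); [exact: contB|exact: contB|move=> x].
    have := maj_mono Hg x nm; have := chi1 N x; have := chi0 N x.
    by move: (g n x) (g m x) (chi N x) => p q w; nra.
  apply: (@outer_mean_le _ (fun n x => g n x - g n x * chi N x)); split.
  - by move=> n; exact: contB.
  - move=> n x; rewrite subr_ge0 -[leRHS]mulr1 ler_wpM2l//.
  - move=> n x; have := maj_nd Hg n x; have := chi1 N x; have := chi0 N x.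
    by move: (g n x) (g n.+1 x) (chi N x) => p q w; nra.
  - move=> x [Ax zx] t t1; have [n tn] := maj_sup Hg Ax t1.
    by exists n; rewrite /chi ball_bump_out// mulr0 subr0.
  (* From the index N on, the mean of g_m chi_N is at least that of g_N chi_N, hence more than s -
     e/2. *)
  - move=> n; apply: le_trans (mono n (maxn n N) (leq_maxl _ _)) _.
    rewrite meanB//.
    have := maj_le Hg (maxn n N).
    have : b N <= L (fun x => g (maxn n N) x * chi N x).
      apply: (mean_mono Lm) => // x; rewrite ler_wpM2r//.
      by apply: (maj_mono Hg); exact: leq_maxr.
    by rewrite -/s in bN; lra.
by lra.
Qed.

End outer_measure.

(** Balls are Caratheodory measurable, hence so are open sets, as countable unions of balls, and
    then Borel sets. The measure is given by the formula [outer_mean], which [outer_mean_push] can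
    transport directly. *)
Lemma riesz_probability (L : (M -> R) -> R) : mean L ->
  exists m : borel_prob R M, forall A : set (borel M), measurable A ->
    m A = (outer_mean L A)%:E.
Proof.
move=> Lm; pose om (A : set M) : \bar R := (outer_mean L A)%:E.
have om0 : om set0 = 0%E by rewrite /om outer_mean0.
have om_ge0 A : (0 <= om A)%E by rewrite lee_fin outer_mean_ge0.
have om_le : {homo om : A B / A `<=` B >-> (A <= B)%E}.
  by move=> A B AB; rewrite lee_fin le_outer_mean.
have om_sub : sigma_subadditive om.
  move=> F; have [->|] := eqVneq (\sum_(n <oo) om (F n))%E +oo%E.
    by rewrite leey.
  rewrite -ltey => fin.
  have s0 : (0 <= \sum_(n <oo) om (F n))%E by exact: nneseries_ge0.
  have sfin : (\sum_(n <oo) om (F n))%E \is a fin_num by rewrite ge0_fin_numE.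
  rewrite -(fineK sfin) lee_fin; apply: (outer_mean_bigcup Lm) => n.
  rewrite -lee_fin (fineK sfin) -sumEFin.
  have := @nneseries_lim_ge R (fun k => om (F k)) xpredT 0%N n (fun k _ _ => om_ge0 (F k)).
  by rewrite big_mkord.
pose mu : {outer_measure set M -> \bar R} := HB.pack om
  (isOuterMeasure.Build R M om om0 om_ge0 om_le om_sub).
have mball z r : mu.-caratheodory (ball z r).
  apply: le_caratheodory_measurable => X.
  by rewrite /= /om -EFinD lee_fin outer_mean_ball.
have mopen (U : set M) : open U -> mu.-caratheodory U.
  move=> oU; have [s ds] := compact_dense_sequence cM.
  pose B n k := if pselect (ball (s n) k.+1%:R^-1 `<=` U)
    then ball (s n) k.+1%:R^-1 else set0.
  have -> : U = \bigcup_n \bigcup_k B n k.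
    apply/seteqP; split=> [x Ux|x [n _ [k _]]]; last first.
      by rewrite /B; case: pselect => // sU /sU.
    have /nbhs_ballP[e /= e0 He] : nbhs x U by exact: open_nbhs_nbhs.
    have e2 : 0 < e / 2 by lra.
    have [k] := ltr_add_invr e2; rewrite add0r => ke.
    have [//|n snx] := ds x k.+1%:R^-1 _.
    exists n => //; exists k => //; rewrite /B; case: pselect => [sU|nsU].
      by rewrite /= ball_mdist.
    exfalso; apply: nsU => y; rewrite ball_mdist => sny; apply: He; rewrite ball_mdist.
    apply: lt_trans (mdist_lt_add snx sny) _.
    by move: ke; set q := _^-1; lra.
  apply: caratheodory_measurable_bigcup => n.
  apply: caratheodory_measurable_bigcup => k.
  rewrite /B; case: pselect => sU /=; first exact: mball.
  exact: (caratheodory_measurable_set0 mu).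
have mborel (A : set (borel M)) : measurable A -> mu.-caratheodory A.
  have sub : <<s @open M >> `<=` mu.-cara.-measurable.
    apply: smallest_sub; last by move=> U oU; exact: mopen.
    exact: sigma_algebra_measurable.
  by move=> mA; exact: sub.
have m0 : (om : set (borel M) -> \bar R) set0 = 0%E by [].
have msa : semi_sigma_additive (om : set (borel M) -> \bar R).
  move=> F mF tF mUF.
  apply: (@caratheodory_measure_sigma_additive _ _ mu) => //.
    by move=> n; exact: (mborel _ (mF n)).
  exact: (mborel _ mUF).
have m1 : (om : set (borel M) -> \bar R) setT = 1%E.
  by rewrite /om outer_mean_setT.
pose m' : {measure set (borel M) -> \bar R} :=
  HB.pack (om : set (borel M) -> \bar R)
    (isMeasure.Build _ (borel M) R om m0 om_ge0 msa).
pose m : probability (borel M) R := HB.pack (Measure.sort m')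
  (Measure_isProbability.Build _ (borel M) R m' m1).
by exists m.
Qed.

End riesz.

(** * Ultralimits of energies *)

Section ultralimits.
Context {R : realType} (U : set_system nat) {UU : UltraFilter U}.

Lemma ultra_compact_cvg (T : topologicalType) (A : set T) (u : nat -> T) :
  compact A -> U [set n | A (u n)] -> exists2 p, A p & u @ U --> p.
Proof.
move=> cA UA; have [p [Ap clp]] := cA (u @ U) _ UA.
exists p => // V Vp; have [//|UV] := in_ultra_setVsetC (u @^-1` V) UU.
by have [q [nVq Vq]] := clp (~` V) V UV Vp.
Qed.

Lemma ultra_bounded_cvg (u : nat -> R) (B : R) :
  U [set n | `|u n| <= B] -> cvg (u @ U).
Proof.
move=> UB; have UI : U [set n | `[- B, B]%classic (u n)].
  by apply: filterS UB => n /=; rewrite in_itv/= ler_norml.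
have [p _ up] := ultra_compact_cvg (@segment_compact R (- B) B) UI.
by apply/cvg_ex; exists p.
Qed.

Lemma weak_cvg_integral (X : ptopologicalType) (mus : nat -> borel_prob R X)
    (mu : borel_prob R X) (phi : X -> R) :
  mus @ U --> mu -> continuous phi -> (exists B : R, forall x, `|phi x| <= B) ->
  (fun n => \int[mus n]_x phi x) @ U --> \int[mu]_x phi x.
Proof.
move=> musU cphi bphi.
pose Phi : bounded_continuous R X := exist _ phi (conj cphi bphi).
have c1 : continuous (@integral_against R X : borel_prob R X -> _).
  exact: initial_continuous.
have c2 : continuous (fun h : prod_topology (fun _ : bounded_continuous R X => R) => h Phi).
  exact: (@proj_continuous {classic (bounded_continuous R X)} (fun=> R) Phi).
have h1 := cvg_comp _ _ musU (c1 mu).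
exact: (cvg_comp _ _ h1 (c2 _)).
Qed.

End ultralimits.

Section energy_against_properties.
Context {R : realType} {M : pmetricType R} (cM : compact [set: M]).
Context (a : R) (a0 : 0 < a).
Implicit Types (nu : borel_prob R M) (phi psi : M -> R).

Lemma bmf_against N nu phi : continuous phi ->
  bmf (fun x : borel M => phi x * potential a N nu x).
Proof.
by move=> cphi; apply: bmfM; [exact: bmf_continuous|exact: bmf_potential].
Qed.

Lemma energy_against_mono N nu phi psi : continuous phi -> continuous psi ->
  (forall x, phi x <= psi x) ->
  energy_against a N nu phi <= energy_against a N nu psi.
Proof.
move=> cphi cpsi H; apply: le_Rint; [exact: bmf_against|exact: bmf_against|].
by move=> x; rewrite ler_wpM2r// potential_ge0.
Qed.

Lemma energy_againstD N nu phi psi : continuous phi -> continuous psi ->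
  energy_against a N nu (fun x => phi x + psi x) =
  energy_against a N nu phi + energy_against a N nu psi.
Proof.
move=> cphi cpsi; rewrite /energy_against -RintD; try exact: bmf_against.
by apply: eq_Rintegral => x _; rewrite mulrDl.
Qed.

Lemma energy_againstZ N nu c phi : continuous phi ->
  energy_against a N nu (fun x => c * phi x) = c * energy_against a N nu phi.
Proof.
move=> cphi; rewrite /energy_against -RintZ; last exact: bmf_against.
by apply: eq_Rintegral => x _; rewrite mulrA.
Qed.

Lemma energy_against_cst N nu (c : R) :
  energy_against a N nu (fun=> c) = c * energy a N nu.
Proof. by rewrite /energy_against RintZ//; exact: bmf_potential. Qed.

Lemma energy_against_dist N nu phi psi (e : R) :
  continuous phi -> continuous psi -> (forall x, `|phi x - psi x| <= e) ->
  `|energy_against a N nu phi - energy_against a N nu psi| <= e * energy a N nu.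
Proof.
move=> cphi cpsi H; rewrite -energy_against_cst ler_norml.
have cc c := @cont_cst R M c.
have := @energy_against_mono N nu phi (fun x => psi x + e) cphi (contD cpsi (cc _)).
have := @energy_against_mono N nu psi (fun x => phi x + e) cpsi (contD cphi (cc _)).
rewrite !energy_againstD// => H1 H2.
have {}H1 : energy_against a N nu psi <=
    energy_against a N nu phi + energy_against a N nu (fun=> e).
  by apply: H1 => x; have := H x; rewrite ler_norml; lra.
have {}H2 : energy_against a N nu phi <=
    energy_against a N nu psi + energy_against a N nu (fun=> e).
  by apply: H2 => x; have := H x; rewrite ler_norml; lra.
by apply/andP; split; lra.
Qed.

End energy_against_properties.

(** * Sequences along which the contraction fails *)

Section non_contraction.
Context {R : realType} {M : pmetricType R} (cM : compact [set: M]).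
Context (a C0 : R) (a0 : 0 < a).
Context (mus : nat -> borel_prob R (homeo M)) (nus rhos : nat -> borel_prob R M).
Context (Ns : nat -> nat).
Context (mom : forall n, bounded_moment a C0 (mus n)).
Context (conv : forall n, is_convolution (mus n) (nus n) (rhos n)).

Let E n := energy a (Ns n) (nus n).
Let F n := energy a (Ns n) (rhos n).

Context (bad : forall n, (1 - n.+2%:R^-1) * E n + n%:R < F n).

Let E0 n : 0 <= E n. Proof. exact: energy_ge0. Qed.
Let F0 n : 0 <= F n. Proof. exact: energy_ge0. Qed.

(** How far f is, seen through [psi], from carrying the energy measure of [nus n] to that of
    [rhos n]. *)
Definition discrepancy n (psi : M -> R) (f : homeo M) : R :=
  `|energy_against a (Ns n) (nus n) (psi \o f) -
    energy_against a (Ns n) (rhos n) psi|.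

Lemma bmf_discrepancy n psi : continuous psi ->
  bmf (discrepancy n psi : borel (homeo M) -> R).
Proof.
move=> cpsi; apply: bmf_norm; apply: bmfB; last exact: bmf_cst.
by apply: bmf_energy_against => //; exact: bmf_continuous.
Qed.

Lemma exp_scale (k : nat) : expR (- k.+1%:R) < k.+1%:R^-1 :> R.
Proof.
rewrite expRN ltf_pV2 ?posrE ?expR_gt0//.
by apply: lt_le_trans (expR_ge1Dx _); rewrite ltrDr.
Qed.

(** With psi = 0, the coefficient of F on the right of the averaged inequality is (5/4) (1 + 6/256),
    well below 2, so that F can be absorbed on the left. *)
Lemma energies_bounded : exists2 C : R, 0 <= C & forall n, F n <= 2 * E n + C.
Proof.
have [|||C C_ge0 HC] := @averaged_inequality R M cM a C0 a0 (1 / 4) (1 / 16) 0.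
- by lra.
- by lra.
- by lra.
exists (2 * C) => [|n]; first lra.
have c0 := @cont_cst R M 0.
have z1 (x : M) : `|0 : R| <= 1 by rewrite normr0 ler01.
have z2 (x y : M) : mdist x y < expR (- 0%:R) -> `|0 - 0 : R| <= 1 / 16.
  by move=> _; rewrite subrr normr0 divr_ge0.
have H := HC (Ns n) (mus n) (nus n) (rhos n) (fun=> 0) (mom n) (conv n)
  (bmf_continuous cM c0) z1 z2.
clear z1 z2.
have I0 : 0 <= \int[mus n]_f discrepancy n (fun=> 0) f by apply: Rint_ge0 => f; exact: normr_ge0.
move: H I0; rewrite -/(E n) -/(F n) /discrepancy.
set I := \int[_]_f _; move=> H I0.
have : (1 + 6 * (1 / 16) ^+ 2) * F n <= (1 + 6 / 256) * F n.
  by rewrite expr2 ler_wpM2r//; lra.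
move: (F0 n) (E0 n) H; rewrite !expr2; move: (F n) (E n) => u v; nra.
Qed.

(** The assumed failure forces n < F n, and F n <= 2 E n + C. *)
Lemma energy_large (B : R) : exists n0, forall n, (n0 <= n)%N -> B <= E n.
Proof.
have [C C_ge0 HC] := energies_bounded.
exists (Num.trunc (2 * `|B| + C)).+1 => n n0n.
have : 2 * `|B| + C < n%:R by apply: lt_le_trans (truncnS_gt _) _; rewrite ler_nat.
have : (1 - n.+2%:R^-1) * E n >= 0.
  by rewrite mulr_ge0// subr_ge0 invf_le1// ler1n.
have := bad n; set w := _ * E n.
by have := HC n; have := ler_norm B; lra.
Qed.

(** The averaged inequality is used with e = eta^2. As F >= (1 - eta^2) E, its main terms cancel up
    to a multiple of eta^2 E, while the discrepancy enters with the factor eta only. This leaves eta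
    I <= 10 eta^2 E for the integral I of the discrepancy. *)
Lemma discrepancy_small (psi : M -> R) (t : R) : continuous psi ->
  (forall x, `|psi x| <= 1) -> 0 < t ->
  exists n0, forall n, (n0 <= n)%N -> \int[mus n]_f discrepancy n psi f <= t * E n.
Proof.
move=> cpsi psi1 t0.
have [eta [eta0 eta4 etat]] : exists eta : R, [/\ 0 < eta, eta <= 1 / 4 & 11 * eta <= t].
  case: (leP t 1) => t1; [exists (t / 11)|exists (1 / 11)]; split; lra.
have [k Hk] := compact_unif_continuous cM cpsi eta0.
have osc x y : mdist x y < expR (- k.+1%:R) -> `|psi x - psi y| <= eta.
  by move=> xy; apply/ltW/Hk; exact: lt_trans xy (exp_scale k).
have ee0 : 0 < eta ^+ 2 by rewrite exprn_gt0.
have [C C_ge0 HC] := averaged_inequality cM C0 a0 k.+1 ee0 eta0 eta4.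
(* From the indices chosen here on, the additive constant C is at most eta^2 E and the defect
   1/(n+2) at most eta^2. *)
have [n1 Hn1] := energy_large (C / (eta * eta)).
exists (maxn n1 (Num.trunc (eta * eta)^-1).+1) => n.
rewrite geq_max => /andP[/Hn1 En n2].
have nq : n.+2%:R^-1 <= eta * eta.
  rewrite -[leRHS]invrK lef_pV2 ?posrE ?invr_gt0 ?mulr_gt0//.
  apply: (le_trans (ltW (truncnS_gt _))); rewrite ler_nat.
  by apply: leq_trans n2 _; rewrite -addn2 leq_addr.
pose I := \int[mus n]_f discrepancy n psi f.
have H : 2 * F n <= (1 + eta ^+ 2) *
    (E n + (1 + 6 * eta ^+ 2) * F n - eta * I) + C.
  exact: HC (Ns n) (mus n) (nus n) (rhos n) psi (mom n) (conv n)
    (bmf_continuous cM cpsi) psi1 osc.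
have I0 : 0 <= I by apply: Rint_ge0 => f; exact: normr_ge0.
have badn : (1 - eta * eta) * E n <= F n.
  apply: le_trans (ltW (bad n)); rewrite -[leLHS]addr0 lerD// ler_wpM2r//.
  by rewrite lerD2l lerN2.
have CE : C <= eta * eta * E n.
  by move: En; rewrite ler_pdivrMr ?mulr_gt0// mulrC.
have key : eta * I <= 10 * (eta * eta) * E n.
  rewrite expr2 in H ee0.
  have e16 : eta * eta <= 1 / 16 by nra.
  move: (E0 n) (F0 n) H badn CE ee0 eta4 eta0 I0.
  move: (E n) (F n) => u v.
  move: (eta * eta) e16 => q q16 u0 v0 H bd CE q0 _ eta0' I0.
  have : eta * I <= (1 + q) * (eta * I).
    by rewrite ler_peMl ?mulr_ge0 ?(ltW eta0')//; lra.
  have qq : q * q <= q / 16 by nra.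
  have qq0 : 0 <= q * q by nra.
  have pos : 0 <= 2 - (1 + q) * (1 + 6 * q) by lra.
  have : u * (1 - q) * (2 - (1 + q) * (1 + 6 * q)) <= v * (2 - (1 + q) * (1 + 6 * q)).
    by rewrite ler_wpM2r// mulrC.
  have : u * (1 - 9 * q) <= u * (1 - q) * (2 - (1 + q) * (1 + 6 * q)).
    by rewrite -mulrA ler_wpM2l//; nra.
  by nra.
rewrite -/I; have : I <= 10 * eta * E n.
  rewrite -(ler_pM2l eta0).
  by have -> : eta * (10 * eta * E n) = 10 * (eta * eta) * E n by ring.
by move=> H'; apply: le_trans H' _; rewrite ler_wpM2r//; lra.
Qed.

End non_contraction.

(** * The limit functionals and their exchange on the support *)

Section non_contraction_limit.
Context {R : realType} {M : pmetricType R} (cM : compact [set: M]).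
Context (a C0 : R) (a0 : 0 < a).
Context (mus : nat -> borel_prob R (homeo M)) (nus rhos : nat -> borel_prob R M).
Context (Ns : nat -> nat).
Context (mom : forall n, bounded_moment a C0 (mus n)).
Context (conv : forall n, is_convolution (mus n) (nus n) (rhos n)).

Let E n := energy a (Ns n) (nus n).
Let F n := energy a (Ns n) (rhos n).

Context (bad : forall n, (1 - n.+2%:R^-1) * E n + n%:R < F n).

Context (U : set_system nat) (UU : UltraFilter U) (Uoo : \oo `<=` U).

Lemma ultra_eventually (P : nat -> Prop) :
  (exists n0, forall n, (n0 <= n)%N -> P n) -> U [set n | P n].
Proof. by move=> [n0 Hn0]; apply: Uoo; exists n0. Qed.

Lemma ultra_energy_ge (B : R) : U [set n | B <= E n].
Proof.
by apply: ultra_eventually; exact: (energy_large cM a0 mom conv bad B).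
Qed.

(* Normalised by the energies of [nus] even when [sigmas] is [rhos]. *)
Definition mean_against (sigmas : nat -> borel_prob R M) n (phi : M -> R) :=
  energy_against a (Ns n) (sigmas n) phi / E n.

Definition ultra_mean sigmas (phi : M -> R) : R :=
  lim (mean_against sigmas ^~ phi @ U).

Lemma mean_against_cvg sigmas (c : R) phi :
  U [set n | energy a (Ns n) (sigmas n) <= c * E n] -> continuous phi ->
  (mean_against sigmas) ^~ phi @ U --> ultra_mean sigmas phi.
Proof.
move=> Uc cphi; have [_ [b Hb]] := bmf_continuous cM cphi.
suff : cvg ((mean_against sigmas) ^~ phi @ U) by [].
apply: (@ultra_bounded_cvg _ _ _ _ (`|b| * `|c|)).
apply: filterS2 Uc (ultra_energy_ge 1) => n /= cn E1.
have E_gt0 : 0 < E n by exact: lt_le_trans E1.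
rewrite /mean_against normrM normfV (gtr0_norm E_gt0) ler_pdivrMr//.
have c0 := @cont_cst R M 0.
have H x : `|phi x - 0| <= `|b| by rewrite subr0 (le_trans (Hb x))// ler_norm.
have := energy_against_dist cM a0 (Ns n) (sigmas n) cphi c0 H.
rewrite energy_against_cst// mul0r subr0 => /le_trans; apply.
rewrite -mulrA ler_wpM2l// (le_trans cn)// ler_wpM2r ?ler_norm//.
exact: ltW.
Qed.

Lemma ultra_mean_mean sigmas (c : R) :
  U [set n | energy a (Ns n) (sigmas n) <= c * E n] ->
  (fun n => energy a (Ns n) (sigmas n) / E n) @ U --> (1 : R) ->
  mean (ultra_mean sigmas).
Proof.
move=> Uc U1; have cvgs phi := @mean_against_cvg sigmas c phi Uc.
have uniq (u : nat -> R) (l l' : R) : u @ U --> l -> u @ U --> l' -> l = l'.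
  by move=> ul ul'; exact: (cvg_unique _ ul ul').
split.
- move=> phi psi cphi cpsi le; apply: (ler_cvg_to (cvgs _ cphi) (cvgs _ cpsi)).
  apply: filterS (ultra_energy_ge 1) => n /= E1; rewrite /mean_against ler_pM2r.
    exact: energy_against_mono.
  by rewrite invr_gt0; exact: lt_le_trans E1.
- move=> phi psi cphi cpsi; apply: uniq (cvgs _ (contD cphi cpsi)) _.
  rewrite (_ : _ ^~ _ = fun n => mean_against sigmas n phi + mean_against sigmas n psi).
    by apply: cvgD; exact: cvgs.
  by apply/funext => n; rewrite /mean_against energy_againstD// mulrDl.
- move=> k phi cphi; apply: uniq (cvgs _ (contM (@cont_cst R M k) cphi)) _.
  rewrite (_ : _ ^~ _ = fun n => k * mean_against sigmas n phi).
    by apply: cvgM; [exact: cvg_cst|exact: cvgs].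
  by apply/funext => n; rewrite /mean_against energy_againstZ// mulrA.
- apply: uniq (cvgs _ (@cont_cst R M 1)) _.
  rewrite (_ : _ ^~ _ = fun n => energy a (Ns n) (sigmas n) / E n)//.
  by apply/funext => n; rewrite /mean_against energy_against_cst// mul1r.
Qed.

Lemma ultra_mean_nus : mean (ultra_mean nus).
Proof.
apply: (@ultra_mean_mean _ 1); first by apply: filterS (ultra_energy_ge 1) => n _ /=; rewrite mul1r.
apply: cvg_near_cst; apply: filterS (ultra_energy_ge 1) => n /= E1.
by rewrite divff// gt_eqF//; exact: lt_le_trans E1.
Qed.

Lemma rhos_le : exists c, U [set n | energy a (Ns n) (rhos n) <= c * E n].
Proof.
have [C C_ge0 HC] := energies_bounded cM a0 Ns mom conv.
exists (2 + C); apply: filterS (ultra_energy_ge 1) => n /= E1.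
apply: le_trans (HC n) _; rewrite (mulrDl 2 C); apply: lerD => //.
by rewrite ler_peMr.
Qed.

(** For psi = 1 the discrepancy is |E - F| for every f, so its smallness says that F / E tends to
    1. *)
Lemma ultra_mean_rhos : mean (ultra_mean rhos).
Proof.
have [c Hc] := rhos_le; apply: (@ultra_mean_mean _ c) => //.
apply/cvgrPdist_le => t t0.
have c1 := @cont_cst R M 1.
have one (x : M) : `|1 : R| <= 1 by rewrite normr1.
have := ultra_eventually (discrepancy_small cM a0 mom conv bad c1 one t0).
apply: filterS2 (ultra_energy_ge 1) => n /= E1.
have E_gt0 : 0 < E n by exact: lt_le_trans E1.
rewrite (_ : (fun f => _) = fun=> `|E n - F n|); last first.
  apply/funext => f; rewrite /discrepancy energy_against_cst// mul1r.
  by rewrite (energy_against_cst cM _ _ _ 1) mul1r.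
rewrite Rint_cst => H.
have -> : 1 - energy a (Ns n) (rhos n) / E n = (E n - F n) / E n.
  by rewrite mulrBl divff// gt_eqF.
by rewrite normrM normfV (gtr0_norm E_gt0) ler_pdivrMr.
Qed.

Context (mu : borel_prob R (homeo M)) (mus_mu : mus @ U --> mu).

Lemma homeo_continuous_real (b : homeo M -> R) :
  (forall (f : homeo M) (e : R), 0 < e -> exists2 d : R, 0 < d &
     forall g : homeo M, (forall x, mdist (f x) (g x) < d) -> `|b f - b g| < e) ->
  continuous b.
Proof.
move=> H f A /nbhs_ballP[e /= e0 He]; have [d d0 Hd] := H f e e0.
apply: (@filterS _ _ (nbhs_filter f) _ _ _ (homeo_near f d0)) => g fg.
by apply: He; exact: Hd.
Qed.

(** If the two values differ by G > 0, then every g close to f0 has a discrepancy of at least a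
    multiple of E, for U-many n. As the integrals of the discrepancies over E tend to 0, [mu] gives
    no mass to a neighbourhood of f0, which is absurd on the support. *)
Lemma ultra_mean_supp (psi : M -> R) (f0 : homeo M) : continuous psi ->
  (forall x, `|psi x| <= 1) -> supp mu f0 ->
  ultra_mean nus (psi \o f0) = ultra_mean rhos psi.
Proof.
move=> cpsi psi1 suppf0.
have [cr Hcr] := rhos_le.
have cpsif (f : homeo M) : continuous (psi \o f).
  by move=> x; apply: continuous_comp; [exact: hfun_continuous|exact: cpsi].
have U1 : U [set n | energy a (Ns n) (nus n) <= 1 * E n].
  by apply: filterS (ultra_energy_ge 1) => n _ /=; rewrite mul1r.
have cv1 := mean_against_cvg U1 (cpsif f0).
have cv2 := mean_against_cvg Hcr cpsi.
apply/eqP; rewrite -subr_eq0 -normr_eq0 eq_le normr_ge0 andbT leNgt.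
apply/negP => gap.
set G := `|_| in gap; pose c : R := G / 2; have c0 : 0 < c by rewrite /c; lra.
pose dif (g : homeo M) (x : M) : R := `|psi (g x) - psi (f0 x)|.
have dif2 g x : dif g x <= 2.
  by rewrite /dif (le_trans (ler_normB _ _))//; have := psi1 (g x); have := psi1 (f0 x); lra.
pose s (g : homeo M) := sup (range (dif g)).
have hs g : has_sup (range (dif g)).
  by split; [exists (dif g point), point|exists 2 => _ [x _ <-]].
have s_ge g x : dif g x <= s g by apply: ub_le_sup; [exact: (hs g).2|exists x].
have s_le g (t : R) : (forall x, dif g x <= t) -> s g <= t.
  by move=> H; apply: ge_sup; [exact: (hs g).1|move=> _ [x _ <-]].
have s_ge0 g : 0 <= s g by apply: le_trans (s_ge g point); exact: normr_ge0.
(* A continuous bump around f0, needed to pass to the weak limit; [s g] is the uniform distance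
   between psi o g and psi o f0. *)
pose b (g : homeo M) := Num.max 0 (c - s g).
have bcont : continuous b.
  apply: homeo_continuous_real => f e e0.
  have e2 : 0 < e / 2 by lra.
  have [k Hk] := compact_unif_continuous cM cpsi e2.
  exists k.+1%:R^-1 => // g fg.
  have fgs x : `|psi (f x) - psi (g x)| < e / 2 by exact: Hk.
  have s1 : s f <= s g + e / 2.
    apply: s_le => x; have := s_ge g x; have := fgs x; rewrite /dif.
    have := ler_normD (psi (f x) - psi (g x)) (psi (g x) - psi (f0 x)).
    by rewrite addrA subrK; lra.
  have s2 : s g <= s f + e / 2.
    apply: s_le => x; have := s_ge f x; have := fgs x; rewrite /dif.
    have := ler_normD (psi (g x) - psi (f x)) (psi (f x) - psi (f0 x)).
    by rewrite addrA subrK (distrC (psi (g x)) (psi (f x))); lra.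
  rewrite /b ltr_norml; case: (leP 0 (c - s f)); case: (leP 0 (c - s g)) => *;
  by apply/andP; split; lra.
have b01 g : 0 <= b g <= c.
  by rewrite /b le_max lexx /= ge_max (ltW c0) gerBl s_ge0.
have bb : exists B : R, forall g, `|b g| <= B.
  by exists c => g; have /andP[b0 bc] := b01 g; rewrite ger0_norm.
have bmb : bmf (b : borel (homeo M) -> R).
  by split => //; exact: continuous_borel_real.
have intb := weak_cvg_integral mus_mu bcont bb.
have intb_le0 : \int[mu]_f b f <= 0.
  apply/ler_addgt0Pr => t t0; rewrite add0r.
  apply: (cvgr_to_le intb).
  have sm := ultra_eventually (discrepancy_small cM a0 mom conv bad cpsi psi1 t0).
  have dist : (fun n => `|mean_against nus n (psi \o f0) - mean_against rhos n psi|) @ U --> G.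
    by apply: cvg_norm; apply: cvgB.
  have cG : c < G by rewrite /c ltr_pdivrMr// mulr_natr mulr2n ltrDl.
  have big : U [set n | c < `|mean_against nus n (psi \o f0) - mean_against rhos n psi|].
    exact: (cvgr_gt _ dist).
  apply: filterS3 (ultra_energy_ge 1) sm big => n /= E1 smn bign.
  have E_gt0 : 0 < E n by exact: lt_le_trans E1.
  have bD : bmf (discrepancy a nus rhos Ns n psi : borel (homeo M) -> R).
    exact: bmf_discrepancy.
  (* Triangle inequality: the discrepancy exceeds c E at f0 and changes by at most (s g) E from f0
     to g. *)
  suff le1 g : E n * b g <= discrepancy a nus rhos Ns n psi g.
    rewrite -(ler_pM2l E_gt0) -RintZ// (mulrC _ t); apply: le_trans smn.
    by apply: le_Rint => //; exact: bmfZ.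
  have H x : `|(psi \o f0) x - (psi \o g) x| <= s g.
    by rewrite distrC; exact: s_ge.
  have := energy_against_dist cM a0 (Ns n) (nus n) (cpsif f0) (cpsif g) H.
  have : c * E n < `|energy_against a (Ns n) (nus n) (psi \o f0) -
      energy_against a (Ns n) (rhos n) psi|.
    move: bign; rewrite /mean_against -mulrBl normrM normfV (gtr0_norm E_gt0).
    by rewrite ltr_pdivlMr.
  rewrite /discrepancy -/(E n).
  move: (energy_against _ _ (nus n) _) (energy_against _ _ (nus n) _)
    (energy_against _ _ (rhos n) _) => p q w.
  have := ler_normD (q - p) (p - w); rewrite addrA subrK.
  have := normr_ge0 (p - w); rewrite /b; case: (leP 0 (c - s g)) => *.
    by rewrite mulrBr; lra.
  by rewrite mulr0.
(* Conversely, b > c/2 on an open neighbourhood of f0, which has positive mass. *)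
pose V := [set g : homeo M | c / 2 < b g].
have oV : open V.
  have -> : V = b @^-1` [set x | c / 2 < x] by [].
  by apply: open_comp => [x _|]; [exact: bcont|exact: open_gt].
have Vf0 : V f0.
  have sf0 : s f0 = 0.
    by apply/eqP; rewrite eq_le s_ge0 andbT; apply: s_le => x; rewrite /dif subrr normr0.
  by rewrite /V /= /b sf0 subr0 (max_idPr (ltW c0)); lra.
have := suppf0 V oV Vf0.
have mV : measurable (V : set (borel (homeo M))) by exact: open_borel.
have muVfin : mu V \is a fin_num by exact: fin_num_measure.
rewrite -(fineK muVfin) lte_fin => V0.
suff : c / 2 * fine (mu V) <= \int[mu]_f b f.
  have : 0 < c / 2 * fine (mu V) by rewrite mulr_gt0//; lra.
  by lra.
have bV := bmf_indic (R := R) mV.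
rewrite -Rint_indic// -RintZ//; apply: le_Rint => //; first exact: bmfZ.
move=> g; rewrite indicE; case: (boolP (g \in _)) => gV.
  by rewrite mulr1; move: gV; rewrite inE /V /= => /ltW.
by rewrite mulr0; have /andP[] := b01 g.
Qed.

End non_contraction_limit.

(** * Contraction and decay *)

Section contraction.
Context {R : realType} {M : pmetricType R} (cM : compact [set: M]).

(** Composition with f and with its inverse exchanges the majorants of the two sets. *)
Lemma outer_mean_push (L1 L2 : (M -> R) -> R) (f : homeo M) (A : set M) :
  (forall psi, continuous psi -> L1 (psi \o f) = L2 psi) ->
  outer_mean L1 (f @^-1` A) = outer_mean L2 A.
Proof.
move=> L12; rewrite /outer_mean; congr (inf _); apply/seteqP.
have cf (h : M -> M) (phi : M -> R) : continuous h -> continuous phi ->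
    continuous (phi \o h).
  by move=> ch cphi x; apply: continuous_comp; [exact: ch|exact: cphi].
split=> c [g Hg].
  have cg n : continuous (g n \o hinv f).
    by apply: cf; [exact: hinv_continuous|exact: (maj_cont Hg)].
  exists (fun n => g n \o hinv f); split => //.
  - by move=> n x; exact: (maj_ge0 Hg).
  - by move=> n x; exact: (maj_nd Hg).
  - by move=> x Ax t t1; apply: (maj_sup Hg) => //=; rewrite hinvK.
  - move=> n; rewrite -L12//; apply: le_trans (maj_le Hg n).
    rewrite (_ : (g n \o hinv f) \o f = g n)//.
    by apply/funext => x /=; rewrite hfunK.
exists (fun n => g n \o f); split.
- by move=> n; apply: cf; [exact: hfun_continuous|exact: (maj_cont Hg)].
- by move=> n x; exact: (maj_ge0 Hg).
- by move=> n x; exact: (maj_nd Hg).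
- by move=> x Ax t t1; exact: (maj_sup Hg).
- by move=> n; rewrite L12; [exact: (maj_le Hg)|exact: (maj_cont Hg)].
Qed.

(** By contradiction: failures for d = 1/(n+2) and C = n give two limit functionals exchanged by
    every f in the support of a limit [mu] in K. The measures representing them are what the
    hypothesis on K excludes. *)
Lemma energy_contraction (a C0 : R) (K : set (borel_prob R (homeo M))) :
  0 < a -> compact K -> (forall mu, K mu -> bounded_moment a C0 mu) ->
  (forall mu, K mu -> ~ exists m1 m2 : borel_prob R M,
     {ae mu, forall f : homeo M, forall A : set (borel M), measurable A ->
        pushforward m1 (hfun f : borel M -> borel M) A = m2 A}) ->
  exists d C : R, [/\ 0 < d, d <= 1 / 2, 0 <= C &
    forall N mu nu rho, K mu -> is_convolution mu nu rho ->
      energy a N rho <= (1 - d) * energy a N nu + C].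
Proof.
move=> a0 cK Kmom Kno; apply: contrapT => no.
have ex n : exists p : borel_prob R (homeo M) * borel_prob R M * borel_prob R M * nat,
    [/\ K p.1.1.1, is_convolution p.1.1.1 p.1.1.2 p.1.2 &
      (1 - n.+2%:R^-1) * energy a p.2 p.1.1.2 + n%:R < energy a p.2 p.1.2].
  (* The shift by 2 keeps d at most 1/2. *)
  apply: contrapT => H; apply: no; exists n.+2%:R^-1, n%:R; split => //.
    by rewrite div1r lef_pV2 ?posrE// ler_nat.
  move=> N mu nu rho Kmu cv; rewrite leNgt; apply/negP => lt.
  by apply: H; exists (mu, nu, rho, N).
have /choice[p Hp] := ex.
pose mus n := (p n).1.1.1; pose nus n := (p n).1.1.2.
pose rhos n := (p n).1.2; pose Ns n := (p n).2.
have mom n : bounded_moment a C0 (mus n) by apply: Kmom; case: (Hp n).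
have conv n : is_convolution (mus n) (nus n) (rhos n) by case: (Hp n).
have bad n : (1 - n.+2%:R^-1) * energy a (Ns n) (nus n) + n%:R <
    energy a (Ns n) (rhos n) by case: (Hp n).
(* A single ultrafilter finer than the cofinite filter takes the place of subsequences, both in K
   and for the values of all the functionals. *)
have [U [UU Uoo]] := @ultraFilterLemma nat \oo _.
have UK : U [set n | K (mus n)] by apply: filterE => n; case: (Hp n).
have [mu Kmu mus_mu] := ultra_compact_cvg cK UK.
pose L1 := ultra_mean a nus Ns U nus; pose L2 := ultra_mean a nus Ns U rhos.
have mL1 : mean L1 by exact: ultra_mean_nus.
have mL2 : mean L2 by exact: ultra_mean_rhos.
have [m1 Hm1] := riesz_probability cM mL1.
have [m2 Hm2] := riesz_probability cM mL2.
apply: (Kno _ Kmu); exists m1, m2.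
have [N [mN N0 suppN]] := supp_full cM mu.
exists N; split => // f /= nf; apply: suppN => suppf; apply: nf => A mA.
have mfA : measurable (hfun f @^-1` A : set (borel M)).
  rewrite -[X in measurable X]setTI.
  exact: (continuous_borel (@hfun_continuous _ f)).
rewrite /pushforward Hm1// Hm2//; congr (_%:E); apply: outer_mean_push => psi cpsi.
have [_ [B HB]] := bmf_continuous cM cpsi.
(* [ultra_mean_supp] is about functions bounded by 1; linearity allows rescaling by [b], which is
   positive. *)
pose b := `|B| + 1; have b0 : 0 < b by rewrite /b; have := normr_ge0 B; lra.
have cc := @cont_cst R M b^-1.
have cpsib : continuous (fun x => b^-1 * psi x) by exact: contM.
have psib x : `|b^-1 * psi x| <= 1.
  rewrite normrM ger0_norm ?invr_ge0 ?(ltW b0)// mulrC ler_pdivrMr// mul1r.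
  by have := HB x; have := ler_norm B; rewrite /b; lra.
have psiE : psi = (fun x => b * (b^-1 * psi x)).
  by apply/funext => x; rewrite mulrA divff ?mul1r// gt_eqF.
have cpsibf : continuous ((fun x => b^-1 * psi x) \o f).
  by move=> x; apply: continuous_comp; [exact: hfun_continuous|exact: cpsib].
rewrite psiE (_ : _ \o f = (fun x => b * ((fun x => b^-1 * psi x) \o f) x))//.
rewrite (meanZ mL1)// (meanZ mL2)//; congr (_ * _).
exact: (ultra_mean_supp cM a0 mom conv bad UU Uoo mus_mu).
Qed.

End contraction.

(** * Logarithmic decay of the mass of balls *)

Section log_hoelder.
Context {R : realType} {M : pmetricType R} (cM : compact [set: M]).

Lemma iter_convolution_probability (nu0 : borel_prob R M)
    (mus : nat -> borel_prob R (homeo M)) :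
  exists rhos : nat -> borel_prob R M,
    [/\ rhos 0%N = nu0,
      forall n, is_convolution (mus n) (rhos n) (rhos n.+1) &
      forall n (A : set (borel M)), measurable A ->
        iter_convolution mus nu0 n A = rhos n A].
Proof.
have /choice[next Hnext] (p : borel_prob R (homeo M) * borel_prob R M) :=
  convolution_probability cM p.1 p.2.
pose rhos := fix F n := if n is m.+1 then next (mus m, F m) else nu0.
exists rhos; split => // [n|n].
  exact: (Hnext (mus n, rhos n)).2.
elim: n => [//|n ih] A mA /=.
rewrite -(Hnext (mus n, rhos n)).1//.
apply: eq_integral => f _; apply: ih.
rewrite -[X in measurable X]setTI.
exact: (continuous_borel (@hfun_continuous _ f)).
Qed.

Context (a : R) (a0 : 0 < a).

(** For y in B_r(x), the ball B_r(x) lies in B_2r(y), hence in the ball of radius e^-j about y for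
    all j <= N - 1. So the potential is at least N^a rho(B_r(x)) on B_r(x). *)
Lemma ball_mass_energy N (rho : borel_prob R M) (x : M) (r : R) :
  2 * r <= expR (1 - N%:R) ->
  N%:R `^ a * ball_mass rho r x ^+ 2 <= energy a N rho.
Proof.
move=> rN; pose B : set (borel M) := ball x r.
have mB : measurable B by apply: open_borel; exact: open_mball.
have bB := bmf_indic (R := R) mB.
set p := ball_mass rho r x.
have -> : N%:R `^ a * p ^+ 2 = \int[rho]_y (N%:R `^ a * p * \1_B y).
  by rewrite RintZ// Rint_indic// -/(ball_mass rho r x) -/p expr2 mulrA.
apply: le_Rint => [||y]; [exact: bmfZ|exact: bmf_potential|].
rewrite indicE; case: (boolP (y \in B)) => yB; last first.
  by rewrite mulr0 potential_ge0.
move: yB; rewrite inE /B ball_mdist => xy.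
rewrite mulr1 -(sum_weight a0) mulr_suml; apply: ler_sum => j _.
rewrite ler_wpM2l ?weight_ge0//; apply: ball_mass_mono => z.
rewrite !ball_mdist => xz; apply: lt_le_trans (mdist_lt_add xy xz) _.
have -> : r + r = 2 * r by ring.
apply: le_trans rN _; rewrite ler_expR.
have : (j.+1%:R <= N%:R :> R) by rewrite ler_nat.
by rewrite -natr1; lra.
Qed.

Lemma contraction_iterate (e : nat -> R) (d C : R) : 0 < d -> d <= 1 / 2 ->
  (forall n, e n.+1 <= (1 - d) * e n + C) ->
  forall n, e n <= (1 - d) ^+ n * e 0%N + C / d - C / d * (1 - d) ^+ n.
Proof.
move=> d0 d2 H; elim=> [|n ih]; first by rewrite expr0 mul1r mulr1 addrK.
apply: le_trans (H n) _; apply: (@le_trans _ _ ((1 - d) *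
  ((1 - d) ^+ n * e 0%N + C / d - C / d * (1 - d) ^+ n) + C)).
  by rewrite lerD2r ler_wpM2l//; lra.
rewrite exprS le_eqVlt; apply/orP; left; apply/eqP.
by field; rewrite gt_eqF.
Qed.

(** Take for N the integer part of t = |log r|. As N <= t < kappa^n, the initial energy is at most
    kappa^(n a), which n contractions reduce to at most 1; so the n-th energy is at most 1 + C/d,
    and [ball_mass_energy] applies. *)
Lemma log_hoelder_decay (d C : R) : 0 < d -> d <= 1 / 2 -> 0 <= C ->
  exists C' kappa : R, 1 < kappa /\
    forall (rhos : nat -> borel_prob R M),
      (forall N n, energy a N (rhos n.+1) <= (1 - d) * energy a N (rhos n) + C) ->
      forall n (x : M) (r : R), expR (- kappa ^+ n) < r -> r < 1 ->
        ball_mass (rhos n) r x < C' * `|ln r| `^ (- (a / 2)).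
Proof.
move=> d0 d2 C0; pose l := 1 - d.
have l0 : 0 < l by rewrite /l; lra.
have l1 : l < 1 by rewrite /l; lra.
(* Chosen so that kappa^a (1 - d) = 1. *)
pose kappa := l^-1 `^ a^-1.
have kappa1 : 1 < kappa.
  have one : (1 : R) `^ a^-1 = 1 by rewrite powR1.
  rewrite /kappa -[ltLHS]one gt0_ltr_powR ?nnegrE ?invr_gt0//.
    by rewrite invr_ge0 ltW.
  by rewrite invf_gt1.
have kappa0 : 0 < kappa by lra.
have kappa_a : kappa `^ a = l^-1.
  by rewrite /kappa -powRrM mulVf ?gt_eqF// powRr1 ?invr_ge0 ?(ltW l0).
have kappa_pow n : (kappa ^+ n) `^ a * l ^+ n = 1.
  rewrite -powR_mulrn ?(ltW kappa0)// -powRrM (mulrC n%:R) powRrM.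
  rewrite kappa_a.
  rewrite powR_mulrn ?invr_ge0 ?(ltW l0)// -exprMn mulVf ?gt_eqF//.
  by rewrite expr1n.
pose D := 1 + C / d.
have D1 : 1 <= D by rewrite /D lerDl divr_ge0// ltW.
(* [C1] serves for t >= 2 and [C2] for t < 2, where the mass is bounded by 1; the added 1 makes the
   inequality strict. *)
pose C1 := D * 2 `^ a; pose C2 := 2 `^ (a / 2) : R.
exists (C1 + C2 + 1), kappa; split => // rhos H n x r rk r1.
have r0 : 0 < r by apply: lt_trans rk; exact: expR_gt0.
set p := ball_mass _ _ _.
have p0 : 0 <= p by exact: ball_mass_ge0.
have p1 : p <= 1 by exact: ball_mass_le1.
pose t := - ln r.
have lnr : ln r < 0 by apply: ln_lt0; rewrite r0.
have t0 : 0 < t by rewrite oppr_gt0.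
have rE : r = expR (- t) by rewrite /t opprK lnK.
have tk : t < kappa ^+ n by move: rk; rewrite rE ltr_expR ltrN2.
have -> : `|ln r| = t by rewrite ltr0_norm.
rewrite powRN; pose q := t `^ (a / 2); rewrite -/q.
have q0 : 0 < q by exact: powR_gt0.
rewrite ltr_pdivlMr//.
have C20 : 0 <= C2 by exact: powR_ge0.
have C21 : 1 <= (2 : R) `^ a.
  have one : (1 : R) `^ a = 1 by rewrite powR1.
  by rewrite -[leLHS]one ge0_ler_powR ?nnegrE ?(ltW a0)//; lra.
have C10 : 1 <= C1 by rewrite /C1; nra.
(* For t >= 2 the integer part N of t is at least t/2, which costs the factor 2^a in [C1]. *)
have [t2|t2] := leP 2 t; last first.
  have : q <= C2.
    by rewrite /q /C2 ge0_ler_powR ?nnegrE ?(ltW t0) ?(ltW t2) ?divr_ge0 ?(ltW a0).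
  by nra.
pose N := Num.trunc t.
have Nt : N%:R <= t by rewrite truncn_le// ltW.
have tN : t < N.+1%:R by exact: truncnS_gt.
have t2N : t / 2 <= N%:R by move: tN; rewrite -natr1; lra.
have rN : 2 * r <= expR (1 - N%:R).
  apply: (@le_trans _ _ (expR 1 * expR (- t))); last first.
    by rewrite -expRD ler_expR; lra.
  rewrite rE ler_wpM2r ?expR_ge0//.
  by have := expR_ge1Dx (1 : R); lra.
have E0 : energy a N (rhos 0%N) <= (kappa ^+ n) `^ a.
  apply: le_trans (energy_le cM a0 N _) _.
  rewrite ge0_ler_powR ?nnegrE ?(ltW a0) ?ler0n ?exprn_ge0 ?(ltW kappa0)//.
  by apply: le_trans Nt _; exact: ltW.
have ED : energy a N (rhos n) <= D.
  have ln0 : 0 < l ^+ n by exact: exprn_gt0.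
  apply: le_trans (contraction_iterate d0 d2 (H N) n) _; rewrite -/l.
  apply: (@le_trans _ _ (l ^+ n * energy a N (rhos 0%N) + C / d)).
    by rewrite gerDl oppr_le0 mulr_ge0 ?(ltW ln0)// divr_ge0 ?(ltW d0).
  rewrite /D lerD2r -(kappa_pow n) mulrC ler_wpM2r//.
  exact: ltW.
have pN := le_trans (ball_mass_energy (rhos n) x rN) ED.
have tp : (t / 2) `^ a * p ^+ 2 <= D.
  apply: le_trans pN; rewrite ler_wpM2r ?sqr_ge0//.
  by rewrite ge0_ler_powR ?nnegrE ?(ltW a0) ?ler0n// divr_ge0 ?(ltW t0).
have qq : q * q = (t / 2) `^ a * 2 `^ a.
  rewrite -powRM ?divr_ge0 ?(ltW t0)// divfK//.
  by rewrite /q -powRD -?splitr// (gt_eqF t0) implybT.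
have pq2 : (p * q) * (p * q) <= C1.
  have -> : (p * q) * (p * q) = (t / 2) `^ a * p ^+ 2 * 2 `^ a.
    by rewrite expr2 mulrACA qq; ring.
  by rewrite /C1 ler_wpM2r// powR_ge0.
(* As C1 >= 1, a square bounded by [C1] has its root bounded by [C1] too. *)
have : p * q <= C1.
  rewrite leNgt; apply/negP => lt; have : C1 * C1 < C1 by apply: lt_le_trans pq2; nra.
  by nra.
by lra.
Qed.

End log_hoelder.

Theorem theorem2p1p9 (R : realType) (dim : nat) (M : pmetricType R)
    (g : closed_riemannian R dim M)
    (K : set (borel_prob R (homeo M))) (alpha C0 : R)
    (K_compact : compact K)
    (K_supp : forall mu, K mu -> supp mu `<=` @bilipschitz R M)
    (alpha_gt0 : 0 < alpha)
    (K_moment : forall mu, K mu ->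
      (\int[mu]_(f in @bilipschitz R M)
         (ln (fine (bilip_const f)) `^ alpha)%:E < C0%:E)%E)
    (K_no_common_image : forall mu, K mu ->
      ~ exists m1 m2 : borel_prob R M,
          {ae mu, forall f : homeo M, forall A : set (borel M), measurable A ->
             pushforward m1 (hfun f : borel M -> borel M) A = m2 A}) :
  exists C kappa : R, 1 < kappa /\
    forall (nu0 : borel_prob R M) (mus : nat -> borel_prob R (homeo M)),
      (forall i, K (mus i)) ->
      forall (n : nat) (x : M) (r : R), expR (- kappa ^+ n) < r -> r < 1 ->
        (iter_convolution mus nu0 n (ball x r) <
           (C * `|ln r| `^ (- (alpha / 2)))%:E)%E.
Proof.
have cM : compact [set: M] := cr_compact g.
have mom mu : K mu -> bounded_moment alpha C0 mu.
  by move=> Kmu; split; [exact: K_supp|exact/ltW/K_moment].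
have [d [C [d0 d2 C_ge0 Hd]]] :=
  energy_contraction cM alpha_gt0 K_compact mom K_no_common_image.
have [C' [kappa [kappa1 decay]]] := log_hoelder_decay cM alpha_gt0 d0 d2 C_ge0.
exists C', kappa; split => // nu0 mus Kmus n x r rk r1.
have [rhos [_ conv iterE]] := iter_convolution_probability cM nu0 mus.
have mb : measurable (ball x r : set (borel M)).
  by apply: open_borel; exact: open_mball.
have fin : rhos n (ball x r) \is a fin_num by exact: fin_num_measure.
rewrite iterE// -(fineK fin) lte_fin.
by apply: decay rk r1 => N k; exact: Hd.
Qed.
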